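(* Suppose Assumptions (A1)–(A3) hold. Fix $\kappa_2>1$, let $\kappa_3=\frac14\big(1+(1+8\kappa_2+\frac8{\rho_2(L)})^{1/2}\big)$, $\tilde\kappa_1=\frac{2+9L_f^2}{2\rho_2(L)}$, $\tilde\kappa_4=6(\kappa_2+\frac1{\rho_2(L)})L_f^2+2\big(9(\kappa_2+\frac1{\rho_2(L)})^2L_f^4+3L_f^2\big)^{1/2}$. Let $\beta>\max\{\frac{\tilde\kappa_1}{\kappa_2-1},\kappa_3,\tilde\kappa_4\}$, $\alpha\in(\beta+\tilde\kappa_1,\kappa_2\beta]$, and define $\tilde\epsilon_1=(\alpha-\beta)\rho_2(L)-\frac12(2+9L_f^2)$, $\tilde\epsilon_2=\beta^2\rho(L)+(2\alpha^2+\beta^2)\rho^2(L)+\frac{15}2L_f^2$, $\epsilon_3=\beta-\frac12-\frac\alpha{2\beta^2}-\frac1{2\beta\rho_2(L)}$, $\epsilon_4=2\beta^2+\frac12$, $\tilde\epsilon_5=\frac18-\frac3{2\beta}(\frac1\beta+\frac1{\rho_2(L)}+\frac\alpha\beta)L_f^2$, $\tilde\epsilon_6=\frac3{\beta^2}(1+\frac1{\rho_2(L)}+\frac\alpha\beta)L_f^2+\frac{L_f(1+3L_f)}2$. Let $\eta\in(0,\min\{\tilde\epsilon_1/\tilde\epsilon_2,\epsilon_3/\epsilon_4,\tilde\epsilon_5/\tilde\epsilon_6\})$ and let $\delta_{i,k}>0$ satisfy $\delta_i^a:=\sum_{k=0}^\infty\delta_{i,k}^2<\infty$ for all $i$. Define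 $\tilde\epsilon_7=\eta\min\{\tilde\epsilon_1-\eta\tilde\epsilon_2,\frac18\}$, $\epsilon_8=\frac{\alpha+\beta}{2\beta}+\frac1{2\rho_2(L)}$, $\epsilon_{12}=\Big(\big(\frac1{\beta^2}+\frac1{2\eta\beta}\big)\big(\frac1{\rho_2(L)}+\frac\alpha\beta\big)+\frac1{2\eta\beta^2}+\frac1{\beta^2}+\frac12\Big)\frac{3npL_f^2}4$, $\epsilon_{11}=\big(\frac{15\eta}4+5\eta^2\big)\frac{3npL_f^2}4+\epsilon_{12}$, $\tilde c=\epsilon_8\hat U_0+(\epsilon_{11}+\epsilon_{12})\sum_{i=1}^n\delta_i^a$. Let $\{\boldsymbol x_k\}$ be generated by Algorithm 2. Then for all $T\in\mathbb N_0$, $$\sum_{k=0}^T\big(\|\boldsymbol x_k-\bar{\boldsymbol x}_k\|^2+\|\bar{\boldsymbol g}^0_k\|^2\big)\le\frac{\tilde c}{\tilde\epsilon_7},\qquad f(\bar x_{T+1})-f^*\le\frac{\tilde c}n.$$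
   Context: Setting: $n$ agents on weighted undirected graph $\mathcal G$ with Laplacian $L=(L_{ij})$; $\rho(L)$ largest eigenvalue, $\rho_2(L)$ smallest positive eigenvalue of $L$. $f_i:\mathbb R^p\to\mathbb R$, $f=\frac1n\sum_if_i$, $\mathbb X^*=\arg\min f$, $f^*=\min f$. Assumptions: (A1) $\mathcal G$ connected; (A2) $\mathbb X^*\ne\emptyset$, $f^*>-\infty$; (A3) each $\nabla f_i$ is $L_f$-Lipschitz ($L_f>0$). Deterministic gradient estimator: for differentiable $h:\mathbb R^p\to\mathbb R$ and $\delta>0$, $\hat\nabla h(x,\delta)=\frac1\delta\sum_{l=1}^p(h(x+\delta e_l)-h(x))e_l$, where $e_1,\dots,e_p$ is the standard basis. Algorithm 2 (parameters $\alpha,\beta,\eta>0$, $\delta_{i,k}>0$): $x_{i,0}\in\mathbb R^p$ arbitrary, $\sum_jv_{j,0}=\mathbf 0_p$, and for $k\ge0$: $x_{i,k+1}=x_{i,k}-\eta(\alpha\sum_jL_{ij}x_{j,k}+\beta v_{i,k}+\hat\nabla f_i(x_{i,k},\delta_{i,k}))$, $v_{i,k+1}=v_{i,k}+\eta\beta\sum_jL_{ij}x_{j,k}$. Notation: $\boldsymbol x_k=\mathrm{col}(x_{i,k})$, $\boldsymbol v_k=\mathrm{col}(v_{i,k})$, $\bar x_k=\frac1n\sum_ix_{i,k}$, $\bar{\boldsymbol x}_k=\mathbf 1_n\otimes\bar x_k$, $\boldsymbol K=(I_n-\frac1n\mathbf 1\mathbf 1^\top)\otimes I_p$, $\|z\|_M^2=z^\top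 Mz$, $\bar{\boldsymbol g}^0_k=\mathbf 1_n\otimes\nabla f(\bar x_k)$, $\delta_k=\max_i\delta_{i,k}$, $\boldsymbol h^0_k=\mathrm{col}(\hat\nabla f_1(\bar x_k,\delta_k),\dots,\hat\nabla f_n(\bar x_k,\delta_k))$, $\hat U_k=\|\boldsymbol x_k\|^2_{\boldsymbol K}+\|\boldsymbol v_k+\frac1\beta\boldsymbol h^0_k\|^2_{\boldsymbol K}+n(f(\bar x_k)-f^* )$. *)

(* Defs.v *)
From Stdlib Require Import Reals Relations.
From mathcomp Require Import ssreflect ssrfun ssrbool eqtype ssrnat seq fintype bigop.

Set Implicit Arguments.
Unset Strict Implicit.
Unset Printing Implicit Defensive.

Local Open Scope R_scope.

Definition vec (p : nat) := 'I_p -> R.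

Definition rsum {I : finType} (F : I -> R) : R := \big[Rplus/0]_(i : I) F i.

Definition vadd {p} (u v : vec p) : vec p := fun l => u l + v l.
Definition vsub {p} (u v : vec p) : vec p := fun l => u l - v l.
Definition vscale {p} (c : R) (u : vec p) : vec p := fun l => c * u l.
Definition dot {p} (u v : vec p) : R := rsum (fun l => u l * v l).
Definition norm2 {p} (u : vec p) : R := dot u u.
Definition norm {p} (u : vec p) : R := sqrt (norm2 u).

Definition ebasis {p} (l : 'I_p) : vec p := fun j => if j == l then 1 else 0.

Definition has_gradient {p} (h : vec p -> R) (x g : vec p) : Prop :=
  forall eps, 0 < eps -> exists d, 0 < d /\
    forall y, norm (vsub y x) < d ->
      Rabs (h y - h x - dot g (vsub y x)) <= eps * norm (vsub y x).

Definition hatgrad {p} (h : vec p -> R) (x : vec p) (delta : R) : vec p :=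
  fun j => rsum (fun l : 'I_p =>
             / delta * (h (vadd x (vscale delta (ebasis l))) - h x) * ebasis l j).

Definition weighted_undirected {n} (a : 'I_n -> 'I_n -> R) : Prop :=
  (forall i j, 0 <= a i j) /\ (forall i j, a i j = a j i).

Definition laplacian {n} (a : 'I_n -> 'I_n -> R) (i j : 'I_n) : R :=
  (if i == j then rsum (fun k => a i k) else 0) - a i j.

Definition graph_connected {n} (a : 'I_n -> 'I_n -> R) : Prop :=
  forall i j : 'I_n, clos_refl_trans _ (fun u v => 0 < a u v) i j.

Definition is_eigenvalue {n} (M : 'I_n -> 'I_n -> R) (lam : R) : Prop :=
  exists v : 'I_n -> R, (exists i, v i <> 0) /\
    forall i, rsum (fun j => M i j * v j) = lam * v i.

Definition is_largest_eigenvalue {n} (M : 'I_n -> 'I_n -> R) (r : R) : Prop :=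
  is_eigenvalue M r /\ forall lam, is_eigenvalue M lam -> lam <= r.

Definition is_smallest_pos_eigenvalue {n} (M : 'I_n -> 'I_n -> R) (r : R) : Prop :=
  is_eigenvalue M r /\ 0 < r /\
  forall lam, is_eigenvalue M lam -> 0 < lam -> r <= lam.

Definition favg {n p} (fi : 'I_n -> vec p -> R) (x : vec p) : R :=
  / INR n * rsum (fun i => fi i x).

Definition vavg {n p} (z : 'I_n -> vec p) : vec p :=
  fun l => / INR n * rsum (fun i => z i l).

(** stacked squared norm ||z||^2 and weighted ||z||_K^2 = z^T K z with
    K = (I_n - (1/n) 1 1^T) (x) I_p. *)
Definition snorm2 {n p} (z : 'I_n -> vec p) : R := rsum (fun i => norm2 (z i)).
Definition Knorm2 {n p} (z : 'I_n -> vec p) : R :=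
  rsum (fun i => rsum (fun j => rsum (fun l : 'I_p =>
     z i l * ((if i == j then 1 else 0) - / INR n) * z j l))).

Definition c_kappa3 (kappa2 rho2 : R) : R :=
  / 4 * (1 + sqrt (1 + 8 * kappa2 + 8 / rho2)).
Definition c_kappa1t (Lf rho2 : R) : R := (2 + 9 * Lf ^ 2) / (2 * rho2).
Definition c_kappa4t (kappa2 Lf rho2 : R) : R :=
  6 * (kappa2 + / rho2) * Lf ^ 2
  + 2 * sqrt (9 * (kappa2 + / rho2) ^ 2 * Lf ^ 4 + 3 * Lf ^ 2).

Definition c_eps1t (Lf rho2 alpha beta : R) : R :=
  (alpha - beta) * rho2 - / 2 * (2 + 9 * Lf ^ 2).
Definition c_eps2t (Lf rho alpha beta : R) : R :=
  beta ^ 2 * rho + (2 * alpha ^ 2 + beta ^ 2) * rho ^ 2 + 15 / 2 * Lf ^ 2.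
Definition c_eps3 (rho2 alpha beta : R) : R :=
  beta - / 2 - alpha / (2 * beta ^ 2) - / (2 * beta * rho2).
Definition c_eps4 (beta : R) : R := 2 * beta ^ 2 + / 2.
Definition c_eps5t (Lf rho2 alpha beta : R) : R :=
  / 8 - 3 / (2 * beta) * (/ beta + / rho2 + alpha / beta) * Lf ^ 2.
Definition c_eps6t (Lf rho2 alpha beta : R) : R :=
  3 / beta ^ 2 * (1 + / rho2 + alpha / beta) * Lf ^ 2 + Lf * (1 + 3 * Lf) / 2.
Definition c_eps7t (Lf rho rho2 alpha beta eta : R) : R :=
  eta * Rmin (c_eps1t Lf rho2 alpha beta - eta * c_eps2t Lf rho alpha beta) (/ 8).
Definition c_eps8 (rho2 alpha beta : R) : R :=
  (alpha + beta) / (2 * beta) + / (2 * rho2).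
Definition c_eps12 (n p : nat) (Lf rho2 alpha beta eta : R) : R :=
  ((/ beta ^ 2 + / (2 * eta * beta)) * (/ rho2 + alpha / beta)
   + / (2 * eta * beta ^ 2) + / beta ^ 2 + / 2)
  * (3 * INR n * INR p * Lf ^ 2 / 4).
Definition c_eps11 (n p : nat) (Lf rho2 alpha beta eta : R) : R :=
  (15 * eta / 4 + 5 * eta ^ 2) * (3 * INR n * INR p * Lf ^ 2 / 4)
  + c_eps12 n p Lf rho2 alpha beta eta.

(* Main.v *)
(** With [L] the Laplacian, [y = K x] and [w = K (v + h0 / beta)], and [S] the
    pseudo-inverse of [L], the Lyapunov function is
      [W = 1/2 |y|^2 + 1/2 |w|^2_S + alpha / (2 beta) |w|^2 + <y, w> + n (f xbar - fstar)].
    The choice of weights makes the cross terms [<y, w>] and [<w, L y>] cancel in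
    [W k.+1 - W k]; Young's inequality absorbs the remaining ones. The errors of
    the estimator are of order [Lf * delta], so one step gives
      [W k.+1 + eps7 (|y|^2 + |gradf xbar|^2) <= W k + eps11 delta_k^2 + eps12 delta_(k+1)^2],
    and both claims follow by summation, as [W >= n (f xbar - fstar)] and
    [W 0 <= eps8 * U0]. The quadratic part decouples over the [p]
    coordinates and is treated one coordinate at a time. *)
Require Import Defs.
From Stdlib Require Import Reals Relations Lra FunctionalExtensionality.
From mathcomp Require Import ssreflect ssrfun ssrbool eqtype ssrnat seq fintype bigop.
From mathcomp Require Import ssralg matrix Rstruct.

Local Open Scope R_scope.

(** * Finite sums and symmetric matrices *)

(** [rho] and [rho2] are given only as extreme eigenvalues, so what they say about quadratic forms
    has to be derived. This is done variationally in [rayleigh_min], from the completeness of the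
    reals and a determinant, with no diagonalisation. The zero eigenvalue of the Laplacian obstructs
    both the lower bound and the inverse; shifting it to [rho2] along the constants removes it. The
    anchor [h0] is evaluated at the mean point with the common [deltak], so its drift involves only
    the move of the mean and the estimator errors at two consecutive times; hence the term in
    delta_(k+1)^2. The squared mean estimate that the drift produces is paid for by the descent of
    f, which is the role of the bound on eta by eps5 and eps6. The term <y, w> of W is there for
    dissipation: its increment is the only source of - eta beta |w|^2. Its price is eta beta <y, L
    y>, whence alpha - beta in eps1. *)

Lemma Rle_div_r (a b c : R) : 0 < c -> a * c <= b <-> a <= b / c.
Proof.
move=> c0; have E : b / c * c = b by field; lra.
by rewrite -{1}E; split=> h; first (apply: (Rmult_le_reg_r c)); nra.
Qed.

Lemma INR_succ_gt0 m : 0 < INR m.+1.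
Proof. by apply: lt_0_INR; apply/ltP. Qed.

Lemma rsum_ext {I : finType} (F G : I -> R) :
  (forall i, F i = G i) -> rsum F = rsum G.
Proof. by move=> FG; apply: eq_bigr. Qed.

Lemma rsum_ind {I : finType} (P : R -> Prop) (F : I -> R) :
  P 0 -> (forall x y, P x -> P y -> P (x + y)) -> (forall i, P (F i)) ->
  P (rsum F).
Proof. by move=> P0 PD PF; apply: (big_ind P). Qed.

Lemma rsum_plus {I : finType} (F G : I -> R) :
  rsum (fun i => F i + G i) = rsum F + rsum G.
Proof.
apply: (big_rec3 (fun a b c => c = a + b)) => [|i a b c _ ->]; first by lra.
by lra.
Qed.

Lemma rsum_scal {I : finType} (c : R) (F : I -> R) :
  rsum (fun i => c * F i) = c * rsum F.
Proof.
apply: (big_rec2 (fun a b => a = c * b)) => [|i a b _ ->]; first by lra.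
by lra.
Qed.

Lemma rsum_scalr {I : finType} (c : R) (F : I -> R) :
  rsum (fun i => F i * c) = rsum F * c.
Proof.
by rewrite Rmult_comm -rsum_scal; apply: rsum_ext => i; rewrite Rmult_comm.
Qed.

Lemma rsum_opp {I : finType} (F : I -> R) : rsum (fun i => - F i) = - rsum F.
Proof.
have -> : - rsum F = -1 * rsum F by lra.
by rewrite -rsum_scal; apply: rsum_ext => i; lra.
Qed.

Lemma rsum_minus {I : finType} (F G : I -> R) :
  rsum (fun i => F i - G i) = rsum F - rsum G.
Proof. by rewrite rsum_plus rsum_opp. Qed.

Lemma rsum_const (n : nat) (c : R) : rsum (fun _ : 'I_n => c) = INR n * c.
Proof.
rewrite /rsum big_const_ord; elim: n => [|n IH]; first by rewrite /=; lra.
by rewrite iterS IH S_INR; lra.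
Qed.

Lemma rsum_le {I : finType} (F G : I -> R) :
  (forall i, F i <= G i) -> rsum F <= rsum G.
Proof.
move=> FG; apply: (big_rec2 (fun a b => a <= b)) => [|i a b _ ab]; first lra.
by move: (FG i); lra.
Qed.

Lemma rsum_ge0 {I : finType} (F : I -> R) : (forall i, 0 <= F i) -> 0 <= rsum F.
Proof. by move=> F0; apply: (rsum_ind (fun s => 0 <= s)) => // *; lra. Qed.

Lemma rsum0 {I : finType} (F : I -> R) : (forall i, F i = 0) -> rsum F = 0.
Proof. by move=> F0; apply: (rsum_ind (fun s => s = 0)) => // *; lra. Qed.

Lemma rsumE {I : finType} (F : I -> R) : rsum F = (\sum_i F i)%R.
Proof. by []. Qed.

Lemma rsum_swap {I J : finType} (F : I -> J -> R) :
  rsum (fun i => rsum (fun j => F i j)) = rsum (fun j => rsum (fun i => F i j)).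
Proof. by rewrite !rsumE exchange_big. Qed.

Lemma rsum_delta {I : finType} (i : I) (F : I -> R) :
  rsum (fun j => (if i == j then 1 else 0) * F j) = F i.
Proof.
rewrite rsumE (bigD1 i) //= eqxx big1 => [|j /negbTE ji].
  by rewrite GRing.addr0; lra.
by rewrite eq_sym ji; exact: Rmult_0_l.
Qed.

Lemma rsum_ge_term {I : finType} (i : I) (F : I -> R) :
  (forall j, 0 <= F j) -> F i <= rsum F.
Proof.
move=> F0; rewrite -(rsum_delta i F); apply: rsum_le => j.
by move: (F0 j); case: (i == j); lra.
Qed.

Definition mulmv {n} (A : 'I_n -> 'I_n -> R) (u : vec n) : vec n :=
  fun i => rsum (fun j => A i j * u j).

Definition lincomb {n} (s : R) (u : vec n) (t : R) (w : vec n) : vec n :=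
  fun i => s * u i + t * w i.

Definition symmetric_fun {n} (A : 'I_n -> 'I_n -> R) : Prop :=
  forall i j, A i j = A j i.

Lemma mulmv_ext {n} (A : 'I_n -> 'I_n -> R) (u w : vec n) i :
  (forall j, u j = w j) -> mulmv A u i = mulmv A w i.
Proof. by move=> uw; apply: rsum_ext => j; rewrite uw. Qed.

Lemma mulmv_lincomb {n} (A : 'I_n -> 'I_n -> R) s u t w i :
  mulmv A (lincomb s u t w) i = s * mulmv A u i + t * mulmv A w i.
Proof.
rewrite /mulmv -!rsum_scal -rsum_plus; apply: rsum_ext => j.
by rewrite /lincomb; ring.
Qed.

Lemma dot_ext {n} (u u' w w' : vec n) :
  (forall i, u i = u' i) -> (forall i, w i = w' i) -> dot u w = dot u' w'.
Proof. by move=> uu ww; apply: rsum_ext => i; rewrite uu ww. Qed.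

Lemma dotC {n} (u w : vec n) : dot u w = dot w u.
Proof. by apply: rsum_ext => i; ring. Qed.

Lemma dot_lincombl {n} s (u : vec n) t w z :
  dot (lincomb s u t w) z = s * dot u z + t * dot w z.
Proof.
by rewrite /dot -!rsum_scal -rsum_plus; apply: rsum_ext => i; rewrite /lincomb; ring.
Qed.

Lemma dot_lincombr {n} s (u : vec n) t w z :
  dot z (lincomb s u t w) = s * dot z u + t * dot z w.
Proof. by rewrite dotC dot_lincombl !(dotC z). Qed.

Lemma norm2_ge0 {n} (u : vec n) : 0 <= norm2 u.
Proof. by apply: rsum_ge0 => i; nra. Qed.

Lemma sqr_le_norm2 {n} (u : vec n) i : u i ^ 2 <= norm2 u.
Proof.
rewrite (_ : u i ^ 2 = u i * u i); last by ring.
by apply: (rsum_ge_term i (fun i => u i * u i)) => j; nra.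
Qed.

Lemma norm2_eq0 {n} (u : vec n) i : norm2 u <= 0 -> u i = 0.
Proof. by move=> u0; move: (sqr_le_norm2 u i); nra. Qed.

Lemma norm2_gt0 {n} (u : vec n) : (exists i, u i <> 0) -> 0 < norm2 u.
Proof.
by move=> [i ui]; case: (Rle_lt_dec (norm2 u) 0) => // /(norm2_eq0 u i).
Qed.

Lemma dot_mulmv {n} (A : 'I_n -> 'I_n -> R) u w :
  symmetric_fun A -> dot (mulmv A u) w = dot u (mulmv A w).
Proof.
move=> sA; rewrite /dot /mulmv.
rewrite (rsum_ext _ (fun i => rsum (fun j => A i j * u j * w i))); last first.
  by move=> i; rewrite -rsum_scalr.
rewrite rsum_swap; apply: rsum_ext => i; rewrite -rsum_scal.
by apply: rsum_ext => j; rewrite (sA j i); ring.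
Qed.

Lemma mulmv_bound {n} (A : 'I_n -> 'I_n -> R) :
  exists2 C, 0 < C & forall u, Rabs (dot u (mulmv A u)) <= C * norm2 u.
Proof.
pose C := rsum (fun i => rsum (fun j => Rabs (A i j))).
have C0 : 0 <= C by do 2 apply: rsum_ge0 => ?; exact: Rabs_pos.
(* [+ 1] keeps the constant positive even for [A = 0]; [rayleigh_min] divides by it. *)
exists (C + 1) => [|u]; first lra.
have bnd s : s = 1 \/ s = -1 -> s * dot u (mulmv A u) <= C * norm2 u.
  move=> s1; rewrite /C /dot /mulmv -rsum_scal -rsum_scalr.
  apply: rsum_le => i; rewrite -Rmult_assoc -rsum_scal -rsum_scalr.
  apply: rsum_le => j.
  have ui := sqr_le_norm2 u i; have uj := sqr_le_norm2 u j.
  have := Rle_abs (A i j); have := Rle_abs (- A i j); rewrite Rabs_Ropp => Am Ap.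
  have N1 : - norm2 u <= u i * u j by nra.
  have N2 : u i * u j <= norm2 u by nra.
  by case: s1 => ->; nra.
have N := norm2_ge0 u; apply: Rabs_le.
by have := bnd 1 (or_introl erefl); have := bnd (-1) (or_intror erefl); nra.
Qed.

(** Either the determinant is a unit or it vanishes. This is the finite-dimensional fact that
    produces both eigenvectors and the pseudo-inverse. *)
Lemma kernel_or_inverse {n} (A : 'I_n -> 'I_n -> R) :
  (exists u, (exists i, u i <> 0) /\ forall i, mulmv A u i = 0) \/
  (exists B, (forall u i, mulmv B (mulmv A u) i = u i) /\
             (forall u i, mulmv A (mulmv B u) i = u i)).
Proof.
pose M := (\matrix_(i, j) A i j)%R.
have invE (F G : 'I_n -> 'I_n -> R) :
    ((\matrix_(i, j) F i j) *m (\matrix_(i, j) G i j) = 1%:M)%R ->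
    forall u i, mulmv F (mulmv G u) i = u i.
  move=> FG u i; rewrite /mulmv.
  rewrite (rsum_ext _ (fun j => rsum (fun k => F i j * G j k * u k))); last first.
    by move=> j; rewrite -rsum_scal; apply: rsum_ext => k; ring.
  rewrite rsum_swap -(rsum_delta i u); apply: rsum_ext => k; rewrite rsum_scalr.
  congr (_ * _); have := congr1 (fun X : 'M[R]_n => X i k) FG.
  rewrite !mxE => E; transitivity ((i == k)%:R : R)%R; last by case: (i == k).
  by rewrite -E rsumE; apply: eq_bigr => j _; rewrite !mxE.
have [Mu|Mu] := boolP (M \in unitmx).
  right; exists (fun i j => invmx M i j).
  have E : (\matrix_(i, j) invmx M i j)%R = invmx M by apply/matrixP => i j; rewrite mxE.
  by split; apply: invE; rewrite E ?mulVmx ?mulmxV.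
(* [det0P] yields a row vector annihilated from the left, so it is applied to the transpose. *)
left; move: Mu; rewrite -unitmx_tr unitmxE GRing.unitfE negbK => /det0P [w w0 wM].
exists (fun i => w ord0 i); split; last first.
  move=> i; have := congr1 (fun X : 'rV[R]_n => X ord0 i) wM; rewrite !mxE => E.
  rewrite -[RHS]E /mulmv rsumE; apply: eq_bigr => j _.
  by rewrite !mxE /GRing.mul /= Rmult_comm.
have /rV0Pn [i wi] := w0.
by exists i; apply/eqP.
Qed.

(* If A - mu I is positive semidefinite and invertible, it is bounded below by
   a positive multiple of the identity; so at the largest admissible mu it is
   singular. *)
Lemma rayleigh_min {m} (A : 'I_m.+1 -> 'I_m.+1 -> R) :
  symmetric_fun A ->
  exists mu, is_eigenvalue A mu /\ forall u, mu * norm2 u <= dot u (mulmv A u).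
Proof.
move=> sA; have [C C0 bC] := mulmv_bound A.
pose S mu := forall u, mu * norm2 u <= dot u (mulmv A u).
have SC : S (- C).
  move=> u; have := bC u; have := Rle_abs (- dot u (mulmv A u)).
  by rewrite Rabs_Ropp; lra.
have ubS t u : S t -> 0 < norm2 u -> t <= dot u (mulmv A u) / norm2 u.
  by move=> St u0; apply/Rle_div_r => //; apply: St.
(* Any nonzero vector bounds the set [S] above by its Rayleigh quotient; the constant one exists
   because the dimension is positive. *)
have e0 : 0 < norm2 (fun _ : 'I_m.+1 => 1).
  by apply: norm2_gt0; exists ord0; lra.
have [||mu [ubmu lubmu]] := completeness S; last first.
- have Smu : S mu.
    move=> u; case: (Rle_lt_dec (norm2 u) 0) => [u0|u0].
      have -> : dot u (mulmv A u) = 0.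
        by apply: rsum0 => i; rewrite (norm2_eq0 u i u0); ring.
      have -> : norm2 u = 0 by have := norm2_ge0 u; lra.
      by lra.
    apply/Rle_div_r => //; apply: lubmu => t St; exact: ubS.
  exists mu; split=> //.
  pose M i j := A i j - mu * (if i == j then 1 else 0).
  have ME u i : mulmv M u i = mulmv A u i - mu * u i.
    rewrite -(rsum_delta i u) -rsum_scal /mulmv -rsum_minus.
    by apply: rsum_ext => j; rewrite /M; case: (i == j); ring.
  have sM : symmetric_fun M by move=> i j; rewrite /M sA eq_sym.
  have dM u : dot u (mulmv M u) = dot u (mulmv A u) - mu * norm2 u.
    rewrite /norm2 /dot -rsum_scal -rsum_minus.
    by apply: rsum_ext => i; rewrite ME; ring.
  have [[u [u0 Mu]]|[B [BM MB]]] := kernel_or_inverse M.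
    by exists u; split=> // i; move: (Mu i); rewrite ME /mulmv; lra.
  have [K K0 bK] := mulmv_bound B.
  suff /ubmu : S (mu + / K) by have := Rinv_0_lt_compat _ K0; lra.
  (* Positivity of [M] at u - B u / K reads <u, M u> >= 2 |u|^2 / K - <u, B u> / K^2, and <u, B u>
     <= K |u|^2 leaves |u|^2 / K. *)
  move=> u; pose z := lincomb 1 u (- / K) (mulmv B u).
  have : 0 <= dot z (mulmv M z) by rewrite dM; have := Smu z; lra.
  have -> : dot z (mulmv M z) =
      dot u (mulmv M u) - 2 * / K * norm2 u + (/ K) ^ 2 * dot u (mulmv B u).
    rewrite -dot_mulmv // (dot_ext _ (lincomb 1 (mulmv M u) (- / K) u) _ z) //; last first.
      by move=> i; rewrite mulmv_lincomb MB.
    rewrite /z !dot_lincombl !dot_lincombr (dot_mulmv M u u) // (dot_mulmv M u (mulmv B u)) //.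
    rewrite (dot_ext u u (mulmv M (mulmv B u)) u) // -/(norm2 u).
    by ring.
  have := Rle_abs (dot u (mulmv B u)); have := bK u.
  have K1 : K * / K = 1 by field; lra.
  have iK := Rinv_0_lt_compat _ K0.
  rewrite dM => b1 b2 h.
  have : (/ K) ^ 2 * dot u (mulmv B u) <= (/ K) ^ 2 * (K * norm2 u).
    by apply: Rmult_le_compat_l; nra.
  have -> : (/ K) ^ 2 * (K * norm2 u) = / K * norm2 u by field; lra.
  by lra.
- by exists (- C).
exists (dot (fun _ => 1) (mulmv A (fun _ => 1)) / norm2 (fun _ : 'I_m.+1 => 1)).
by move=> t St; apply: ubS.
Qed.

(** * Spectral bounds for the Laplacian *)

Lemma mulmv_scal {n} (A : 'I_n -> 'I_n -> R) c u i :
  mulmv (fun i j => c * A i j) u i = c * mulmv A u i.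
Proof. by rewrite /mulmv -rsum_scal; apply: rsum_ext => j; ring. Qed.

Section Laplacian.
Variables (m : nat) (a : 'I_m.+1 -> 'I_m.+1 -> R).
Hypotheses (wa : weighted_undirected a) (ca : graph_connected a).
Let L := laplacian a.

Lemma laplacian_sym : symmetric_fun L.
Proof.
move=> i j; rewrite /L /laplacian (proj2 wa i j) eq_sym.
by case: eqP => // ->.
Qed.

Lemma mulmv_laplacian u i : mulmv L u i = rsum (fun j => a i j * (u i - u j)).
Proof.
rewrite /mulmv (rsum_ext _ (fun j =>
  (if i == j then 1 else 0) * (rsum (fun k => a i k) * u j) - a i j * u j)).
  rewrite rsum_minus (rsum_delta i (fun j => rsum (fun k => a i k) * u j)).
  rewrite -rsum_scalr -rsum_minus.
  by apply: rsum_ext => j; ring.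
by move=> j; rewrite /L /laplacian; case: (i == j); ring.
Qed.

Lemma rsum_mulmv_laplacian u : rsum (mulmv L u) = 0.
Proof.
suff : rsum (mulmv L u) = - rsum (mulmv L u) by lra.
rewrite (rsum_ext _ _ (mulmv_laplacian u)) {1}rsum_swap -rsum_opp.
apply: rsum_ext => i; rewrite -rsum_opp; apply: rsum_ext => j.
by rewrite (proj2 wa i j); ring.
Qed.

Lemma dot_laplacian u :
  2 * dot u (mulmv L u) = rsum (fun i => rsum (fun j => a i j * (u i - u j) ^ 2)).
Proof.
have E : dot u (mulmv L u) = rsum (fun i => rsum (fun j => a i j * (u i * (u i - u j)))).
  apply: rsum_ext => i; rewrite mulmv_laplacian -rsum_scal.
  by apply: rsum_ext => j; ring.
have -> : forall t, 2 * t = t + t by move=> t; ring.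
rewrite E {1}rsum_swap -rsum_plus; apply: rsum_ext => i.
by rewrite -rsum_plus; apply: rsum_ext => j; rewrite (proj2 wa j i); ring.
Qed.

Lemma laplacian_psd u : 0 <= dot u (mulmv L u).
Proof.
suff : 0 <= 2 * dot u (mulmv L u) by lra.
rewrite dot_laplacian; do 2 apply: rsum_ge0 => ?.
by apply: Rmult_le_pos; [apply: (proj1 wa) | apply: pow2_ge_0].
Qed.

(** All terms of the Dirichlet sum are nonnegative, so each one vanishes and [u] agrees across every
    edge; induction along paths does the rest. *)
Lemma laplacian_kernel u :
  dot u (mulmv L u) <= 0 -> forall i j, u i = u j.
Proof.
move=> u0 i j; elim: {i j}(ca i j) => [i j aij|//|i j k _ -> _ ->//].
have pos i' j' : 0 <= a i' j' * (u i' - u j') ^ 2.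
  by apply: Rmult_le_pos; [apply: (proj1 wa) | apply: pow2_ge_0].
have h1 := rsum_ge_term j (fun j' => a i j' * (u i - u j') ^ 2) (pos i).
have h2 := rsum_ge_term i (fun i' => rsum (fun j' => a i' j' * (u i' - u j') ^ 2))
  (fun i' => rsum_ge0 _ (pos i')).
move: h1 h2; rewrite -dot_laplacian /= => h1 h2.
case: (Req_dec (u i) (u j)) => // uij.
suff : 0 < a i j * (u i - u j) ^ 2 by lra.
by apply: Rmult_lt_0_compat => //; have := Rsqr_pos_lt (u i - u j); rewrite /Rsqr; lra.
Qed.

(** [rayleigh_min] applied to the opposite of [L]. *)
Lemma laplacian_le rho u :
  is_largest_eigenvalue L rho -> dot u (mulmv L u) <= rho * norm2 u.
Proof.
move=> [_ max]; have [|mu [[w [w0 Lw]] low]] := rayleigh_min (fun i j => -1 * L i j).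
  by move=> i j; rewrite laplacian_sym.
have : - mu <= rho.
  apply: max; exists w; split=> // i; move: (Lw i).
  by rewrite -[rsum _]/(mulmv (fun i j => -1 * L i j) w i) mulmv_scal /mulmv; lra.
have := low u; rewrite (dot_ext u u _ (fun i => -1 * mulmv L u i)) //; last first.
  by move=> i; rewrite mulmv_scal.
have -> : dot u (fun i => -1 * mulmv L u i) = -1 * dot u (mulmv L u).
  by rewrite /dot -rsum_scal; apply: rsum_ext => i; ring.
by have := norm2_ge0 u; nra.
Qed.

(** Replaces the square root of [L]: with w = L u, positivity of [L] at w - rho u gives 2 rho |w|^2
    <= <w, L w> + rho^2 <u, w>, and <w, L w> <= rho |w|^2. *)
Lemma laplacian_sqr_le rho u :
  is_largest_eigenvalue L rho -> 0 < rho ->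
  norm2 (mulmv L u) <= rho * dot u (mulmv L u).
Proof.
move=> Lrho rho0; pose w := mulmv L u.
have := laplacian_psd (lincomb 1 w (- rho) u).
rewrite dot_lincombl.
have E z : dot z (mulmv L (lincomb 1 w (- rho) u)) =
    dot z (lincomb 1 (mulmv L w) (- rho) w).
  by apply: dot_ext => // i; rewrite mulmv_lincomb.
rewrite !E !dot_lincombr -(dot_mulmv L u w laplacian_sym) -/w.
have := laplacian_le rho w Lrho; rewrite -/(norm2 w) => h1 h2.
by apply: (Rmult_le_reg_l rho) => //; nra.
Qed.

(* Adding rho2 times the projector onto the constants moves the kernel of L to
   the eigenvalue rho2, without changing L on mean-zero vectors. *)
Let A rho2 i j := L i j + rho2 * / INR m.+1.

Lemma shifted_sym rho2 : symmetric_fun (A rho2).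
Proof. by move=> i j; rewrite /A laplacian_sym. Qed.

Lemma mulmv_shifted rho2 u i :
  mulmv (A rho2) u i = mulmv L u i + rho2 * / INR m.+1 * rsum u.
Proof.
by rewrite /mulmv -rsum_scal -rsum_plus; apply: rsum_ext => j; rewrite /A; ring.
Qed.

Lemma rsum_mulmv_shifted rho2 u : rsum (mulmv (A rho2) u) = rho2 * rsum u.
Proof.
rewrite (rsum_ext _ _ (mulmv_shifted rho2 u)) rsum_plus rsum_mulmv_laplacian rsum_const.
by field; have := INR_succ_gt0 m; lra.
Qed.

(** Summing the eigenvector equation for the least eigenvalue [mu] shows that either mu = rho2 or
    the eigenvector has mean zero. In the second case it is an eigenvector of [L], and mu <= 0 would
    make it constant, hence zero. *)
Lemma shifted_ge rho2 u :
  is_smallest_pos_eigenvalue L rho2 -> rho2 * norm2 u <= dot u (mulmv (A rho2) u).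
Proof.
move=> [_ [rho0 min]].
have [mu [[w [w0 Aw]] low]] := rayleigh_min (A rho2) (shifted_sym rho2).
suff : rho2 <= mu by have := low u; have := norm2_ge0 u; nra.
have sw : rho2 * rsum w = mu * rsum w.
  rewrite -rsum_mulmv_shifted -rsum_scal; exact: rsum_ext.
case: (Req_dec (rsum w) 0) => [w1|w1]; last first.
  by apply: Req_le; apply: (Rmult_eq_reg_r _ _ _ sw w1).
have Lw i : mulmv L w i = mu * w i.
  by rewrite -[RHS]Aw -/(mulmv _ w i) mulmv_shifted w1; ring.
have dw : dot w (mulmv L w) = mu * norm2 w.
  by rewrite /norm2 /dot -rsum_scal; apply: rsum_ext => i; rewrite Lw; ring.
apply: min; first by exists w.
case: (Rlt_le_dec 0 mu) => // mu0; exfalso.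
have wN := norm2_gt0 w w0.
have wc := laplacian_kernel w; rewrite dw in wc.
have {}wc : forall i j, w i = w j by apply: wc; nra.
case: w0 => i; apply.
have : rsum w = INR m.+1 * w i by rewrite -rsum_const; apply: rsum_ext => j.
by have := INR_succ_gt0 m; rewrite w1; nra.
Qed.

Lemma laplacian_ge rho2 u :
  is_smallest_pos_eigenvalue L rho2 -> rsum u = 0 ->
  rho2 * norm2 u <= dot u (mulmv L u).
Proof.
move=> h u0; have := shifted_ge rho2 u h.
by rewrite (dot_ext u u _ (mulmv L u)) // => i; rewrite mulmv_shifted u0; ring.
Qed.

(* On mean-zero vectors S is the pseudo-inverse of L. *)
Lemma laplacian_pinv rho2 :
  is_smallest_pos_eigenvalue L rho2 ->
  exists S, [/\ forall u w, dot (mulmv S u) w = dot u (mulmv S w),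
    forall u i, rsum u = 0 -> mulmv S (mulmv L u) i = u i,
    forall u, 0 <= dot u (mulmv S u)
    & forall u, dot u (mulmv S u) <= / rho2 * norm2 u].
Proof.
move=> h; have rho0 := proj1 (proj2 h).
have [[u [u0 Au]]|[S [SA AS]]] := kernel_or_inverse (A rho2).
  have := shifted_ge rho2 u h; have := norm2_gt0 u u0.
  have -> : dot u (mulmv (A rho2) u) = 0 by apply: rsum0 => i; rewrite Au; ring.
  by nra.
exists S; have dS u w : dot (mulmv S u) w = dot u (mulmv S w).
  rewrite (dot_ext _ (mulmv S u) w (mulmv (A rho2) (mulmv S w))) // -dot_mulmv.
    exact: dot_ext.
  exact: shifted_sym.
have E u : dot u (mulmv S u) = dot (mulmv S u) (mulmv (A rho2) (mulmv S u)).
  by rewrite dotC; apply: dot_ext.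
split=> //.
- move=> u i u0; rewrite -[RHS]SA; apply: mulmv_ext => j.
  by rewrite mulmv_shifted u0; ring.
- move=> u; rewrite E; have := shifted_ge rho2 (mulmv S u) h.
  by have := norm2_ge0 (mulmv S u); nra.
(* Expand |u - rho2 z|^2 >= 0 and use rho2 |z|^2 <= <u, z>. *)
- move=> u; pose z := mulmv S u.
  have := norm2_ge0 (lincomb 1 u (- rho2) z).
  rewrite /norm2 dot_lincombl !dot_lincombr -!/(norm2 _) (dotC z u).
  have := shifted_ge rho2 z h; rewrite -E -/z => h1 h2.
  apply: (Rmult_le_reg_l rho2) => //.
  have -> : rho2 * (/ rho2 * norm2 u) = norm2 u by field; lra.
  by nra.
Qed.

End Laplacian.

(** * One step of the quadratic part of the Lyapunov function *)

(** Cauchy-Schwarz enters as positivity of a binary form, so that the same lemma serves the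
    Euclidean product and the seminorm of [S]. *)
Lemma young (A X B c k1 k2 : R) :
  (forall s t, 0 <= s ^ 2 * A + 2 * s * t * X + t ^ 2 * B) ->
  0 < k1 -> c ^ 2 = 4 * k1 * k2 -> c * X <= k1 * A + k2 * B.
Proof.
move=> q k0 ck; have := q (2 * k1) (- c).
have -> : (- c) ^ 2 = c ^ 2 by ring.
by rewrite ck => h; apply: (Rmult_le_reg_l (4 * k1)); nra.
Qed.

Lemma dot_quad {n} (u w : vec n) s t :
  0 <= s ^ 2 * norm2 u + 2 * s * t * dot u w + t ^ 2 * norm2 w.
Proof.
have := norm2_ge0 (lincomb s u t w).
by rewrite /norm2 dot_lincombl !dot_lincombr (dotC w u); lra.
Qed.

Definition lyap {n} (S : 'I_n -> 'I_n -> R) (alpha beta : R) (y w : vec n) : R :=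
  / 2 * norm2 y + / 2 * dot w (mulmv S w) + alpha / (2 * beta) * norm2 w + dot y w.

(** Coefficient of the squared drift [|K (h0 k.+1 - h0 k)|^2] in one step; it is
    [c_eps12] without the factor [3 n p Lf^2 / 4]. *)
Definition c_drift (rho2 alpha beta eta : R) : R :=
  (/ beta ^ 2 + / (2 * eta * beta)) * (/ rho2 + alpha / beta)
  + / (2 * eta * beta ^ 2) + / beta ^ 2 + / 2.

Section ColumnStep.
Variables (n : nat) (S : 'I_n -> 'I_n -> R) (alpha beta eta rho rho2 : R).
Hypotheses (dS : forall u w, dot (mulmv S u) w = dot u (mulmv S w))
  (S0 : forall u, 0 <= dot u (mulmv S u))
  (S1 : forall u, dot u (mulmv S u) <= / rho2 * norm2 u).
Hypotheses (beta0 : 0 < beta) (ab : beta < alpha) (eta0 : 0 < eta) (rho20 : 0 < rho2).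

Lemma pinv_quad u w s t :
  0 <= s ^ 2 * dot u (mulmv S u) + 2 * s * t * dot u (mulmv S w)
       + t ^ 2 * dot w (mulmv S w).
Proof.
have := S0 (lincomb s u t w).
by rewrite dot_lincombl -!dS !dot_lincombr !dS -(dS w u) (dotC (mulmv S w)); lra.
Qed.

Variables (y w u d De y' w' : vec n).
Hypotheses (Su : forall i, mulmv S u i = y i)
  (y'E : forall i, y' i = y i - eta * (alpha * u i + beta * w i + d i))
  (w'E : forall i, w' i = w i + eta * beta * u i + / beta * De i).

(** [u] stands for L y, [d] for the centred estimator error and [De] for the drift of the centred
    anchor; [L] enters only through [S u = y]. The two opposite terms in <u, De> are kept apart
    because [lyap_step] estimates them separately. *)
Lemma lyap_expand :
  lyap S alpha beta y' w' = lyap S alpha beta y w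
  - eta * (alpha - beta) * dot y u - eta * beta * norm2 w
  - eta * dot y d - eta * dot w d
  + / beta * dot y De + / beta * dot w (mulmv S De)
  + alpha * / beta ^ 2 * dot w De
  + eta * dot y De + eta * alpha * / beta * dot u De
  - eta * alpha * / beta * dot u De - eta * dot w De - eta * / beta * dot d De
  + eta ^ 2 / 2 * (alpha ^ 2 * norm2 u + beta ^ 2 * norm2 w + norm2 d)
  + eta ^ 2 * alpha * beta * dot u w + eta ^ 2 * alpha * dot u d
  + eta ^ 2 * beta * dot w d
  + eta ^ 2 * beta ^ 2 / 2 * dot y u + eta ^ 2 * beta * alpha / 2 * norm2 u
  + / beta ^ 2 / 2 * dot De (mulmv S De) + alpha * / beta ^ 3 / 2 * norm2 De
  - eta ^ 2 * alpha * beta * norm2 u - eta ^ 2 * beta ^ 2 * dot u w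
  - eta ^ 2 * beta * dot u d.
Proof.
pose Y := lincomb 1 y (- eta) (lincomb 1 (lincomb alpha u beta w) 1 d).
pose W := lincomb 1 w 1 (lincomb (eta * beta) u (/ beta) De).
have yY i : y' i = Y i by rewrite y'E /Y /lincomb; ring.
have wW i : w' i = W i by rewrite w'E /W /lincomb; ring.
have dSu z : dot (mulmv S u) z = dot y z by apply: dot_ext.
have -> : lyap S alpha beta y' w' = lyap S alpha beta Y W.
  rewrite /lyap /norm2 (dot_ext y' Y y' Y) // (dot_ext w' W w' W) //.
  by rewrite (dot_ext y' Y w' W) // (dot_ext w' W _ (mulmv S W)) // => i; apply: mulmv_ext.
rewrite /lyap /norm2 -!dS.
have -> : dot (mulmv S W) W = dot (mulmv S w) w + eta ^ 2 * beta ^ 2 * dot y u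
    + / beta ^ 2 * dot (mulmv S De) De + 2 * eta * beta * dot y w
    + 2 * / beta * dot (mulmv S w) De + 2 * eta * dot y De.
  rewrite /W dS !dot_lincombl -!dS !dot_lincombr !dSu.
  rewrite (dS w u) (dS De u) (dS De w) (dotC w (mulmv S u)) (dotC De (mulmv S u)).
  rewrite (dotC De (mulmv S w)) !dSu; field; lra.
rewrite /Y /W !(dot_lincombl, dot_lincombr).
rewrite (dotC u y) (dotC w y) (dotC d y) (dotC d w) (dotC w u) (dotC d u).
rewrite (dotC De w) (dotC De u); field; lra.
Qed.

Hypotheses (yu_ge : rho2 * norm2 y <= dot y u)
  (yu_le : dot y u <= rho * norm2 y) (uu_le : norm2 u <= rho ^ 2 * norm2 y).

Lemma lyap_step :
  lyap S alpha beta y' w' <= lyap S alpha beta y w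
  - eta * ((alpha - beta) * rho2 - 1
           - eta * (beta ^ 2 * rho + (2 * alpha ^ 2 + beta ^ 2) * rho ^ 2)) * norm2 y
  - eta * (c_eps3 rho2 alpha beta - eta * c_eps4 beta) * norm2 w
  + (eta + 5 / 2 * eta ^ 2) * norm2 d
  + c_drift rho2 alpha beta eta * norm2 De.
Proof.
rewrite lyap_expand.
have ib0 := Rinv_0_lt_compat _ beta0; have ie0 := Rinv_0_lt_compat _ eta0.
have ir0 := Rinv_0_lt_compat _ rho20.
have a0 : 0 < alpha by lra.
(* With the inverses as plain variables, the goal becomes polynomial, and linear in its monomials
   once the products below are supplied. *)
set ib := / beta in ib0 *; set ie := / eta in ie0; set ir := / rho2 in ir0.
have ib2 : / beta ^ 2 = ib ^ 2 by rewrite /ib; field; lra.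
have ib3 : / beta ^ 3 = ib ^ 3 by rewrite /ib; field; lra.
have pos2 s t : 0 < s -> 0 < t -> 0 < s * t by exact: Rmult_lt_0_compat.
have e2 := pos2 _ _ eta0 eta0; have b2 := pos2 _ _ beta0 beta0.
have a2 := pos2 _ _ a0 a0; have ib20 := pos2 _ _ ib0 ib0.
(* The Young weights add up to the target constants without slack: for instance eta^2 |w|^2 collects
   2 beta^2 + 1/2, which is eps4, and eta^2 |d|^2 collects 5/2. *)
have y1 := young _ _ _ (- eta) (eta / 2) (eta / 2) (dot_quad y d) ltac:(lra) ltac:(field).
have y2 := young _ _ _ (- eta) (eta / 2) (eta / 2) (dot_quad w d) ltac:(lra) ltac:(field).
have y3 := young _ _ _ ib (eta / 2) (ie * ib ^ 2 / 2) (dot_quad y De)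
  ltac:(lra) ltac:(rewrite /ie; field; lra).
have y4 := young _ _ _ ib (eta * ib / 2) (ie * ib / 2) (pinv_quad w De)
  ltac:(nra) ltac:(rewrite /ie; field; lra).
have y5 := young _ _ _ (alpha * ib ^ 2) (eta * alpha * ib ^ 2 / 2)
  (alpha * ie * ib ^ 2 / 2) (dot_quad w De)
  ltac:(have := pos2 _ _ (pos2 _ _ eta0 a0) ib20; lra) ltac:(rewrite /ie; field; lra).
(* Here <y, De> is read as <u, S De>: the seminorm of [u] is <y, u>, so this piece costs order eta^2
   and no inverse of eta. *)
have y6 := young _ _ _ eta (eta ^ 2 * beta ^ 2 / 2) (ib ^ 2 / 2) (pinv_quad u De)
  ltac:(have := pos2 _ _ e2 b2; lra) ltac:(rewrite /ib; field; lra).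
(* Its share alpha beta / 2 of eta^2 |u|^2 meets the - alpha beta / 2 left by the expansion, so only
   2 alpha^2 + beta^2 remains. *)
have y6' := young _ _ _ (eta * alpha * ib) (eta ^ 2 * alpha * beta / 2) (alpha * ib ^ 3 / 2)
  (dot_quad u De)
  ltac:(have := pos2 _ _ e2 (pos2 _ _ a0 beta0); lra) ltac:(rewrite /ib; field; lra).
have y7 := young _ _ _ (- (eta * alpha * ib)) (eta ^ 2 * alpha ^ 2 / 2) (ib ^ 2 / 2)
  (dot_quad u De) ltac:(have := pos2 _ _ e2 a2; lra) ltac:(field).
have y8 := young _ _ _ (- eta) (eta ^ 2 / 2) (/ 2) (dot_quad w De) ltac:(lra) ltac:(field).
have y9 := young _ _ _ (- (eta * ib)) (eta ^ 2 / 2) (ib ^ 2 / 2) (dot_quad d De)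
  ltac:(lra) ltac:(field).
have y10 := young _ _ _ (eta ^ 2 * alpha * beta) (eta ^ 2 * alpha ^ 2 / 2)
  (eta ^ 2 * beta ^ 2 / 2) (dot_quad u w) ltac:(have := pos2 _ _ e2 a2; lra) ltac:(field).
have y10' := young _ _ _ (eta ^ 2 * alpha) (eta ^ 2 * alpha ^ 2 / 2)
  (eta ^ 2 / 2) (dot_quad u d) ltac:(have := pos2 _ _ e2 a2; lra) ltac:(field).
have y10'' := young _ _ _ (eta ^ 2 * beta) (eta ^ 2 * beta ^ 2 / 2)
  (eta ^ 2 / 2) (dot_quad w d) ltac:(have := pos2 _ _ e2 b2; lra) ltac:(field).
have y11 := young _ _ _ (- (eta ^ 2 * beta ^ 2)) (eta ^ 2 * beta ^ 2 / 2)
  (eta ^ 2 * beta ^ 2 / 2) (dot_quad u w) ltac:(have := pos2 _ _ e2 b2; lra) ltac:(field).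
have y12 := young _ _ _ (- (eta ^ 2 * beta)) (eta ^ 2 * beta ^ 2 / 2)
  (eta ^ 2 / 2) (dot_quad u d) ltac:(have := pos2 _ _ e2 b2; lra) ltac:(field).
have dSu z : dot u (mulmv S z) = dot y z by rewrite -dS; apply: dot_ext.
have uSu : dot u (mulmv S u) = dot y u by exact: dSu.
rewrite !dSu in y6.
have r1 : 0 <= eta * (alpha - beta) * (dot y u - rho2 * norm2 y).
  by apply: Rmult_le_pos; [apply: Rmult_le_pos; lra | lra].
have r2 : 0 <= eta ^ 2 * beta ^ 2 * (rho * norm2 y - dot y u).
  by apply: Rmult_le_pos; [have := pos2 _ _ e2 b2; lra | lra].
have r3 : 0 <= eta ^ 2 * (2 * alpha ^ 2 + beta ^ 2) * (rho ^ 2 * norm2 y - norm2 u).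
  by apply: Rmult_le_pos; [have := pos2 _ _ e2 b2; have := pos2 _ _ e2 a2; lra | lra].
have r4 : 0 <= eta * ib / 2 * (ir * norm2 w - dot w (mulmv S w)).
  by apply: Rmult_le_pos; [nra | have := S1 w; rewrite -/ir; lra].
have r5 : 0 <= (ie * ib / 2 + ib ^ 2) * (ir * norm2 De - dot De (mulmv S De)).
  by apply: Rmult_le_pos; [nra | have := S1 De; rewrite -/ir; lra].
have E3 : c_eps3 rho2 alpha beta = beta - / 2 - alpha * ib ^ 2 / 2 - ib * ir / 2.
  by rewrite /c_eps3 /ib /ir; field; lra.
have EE : c_drift rho2 alpha beta eta =
    (ie * ib / 2 + ib ^ 2) * ir + ie * ib ^ 2 / 2 + alpha * ie * ib ^ 2 / 2
    + alpha * ib ^ 3 + ib ^ 2 + / 2.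
  by rewrite /c_drift /ib /ir /ie; field; lra.
rewrite E3 EE /c_eps4 ib2 ib3.
lra.
Qed.

End ColumnStep.

(** * Lipschitz gradients and the gradient estimator *)

Lemma norm_sqr {p} (u : vec p) : norm u * norm u = norm2 u.
Proof. exact: (sqrt_sqrt _ (norm2_ge0 u)). Qed.

Lemma norm_ge0 {p} (u : vec p) : 0 <= norm u.
Proof. exact: sqrt_pos. Qed.

Lemma norm2_vscale {p} c (u : vec p) : norm2 (vscale c u) = c ^ 2 * norm2 u.
Proof. by rewrite /norm2 /dot -rsum_scal; apply: rsum_ext => l; rewrite /vscale; ring. Qed.

Lemma dot_vscaler {p} c (u w : vec p) : dot u (vscale c w) = c * dot u w.
Proof. by rewrite /dot -rsum_scal; apply: rsum_ext => l; rewrite /vscale; ring. Qed.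

Lemma norm_vscale {p} c (u : vec p) : norm (vscale c u) = Rabs c * norm u.
Proof.
rewrite /norm norm2_vscale sqrt_mult_alt; last exact: pow2_ge_0.
by rewrite -Rsqr_pow2 sqrt_Rsqr_abs.
Qed.

Lemma vaddK {p} (x d : vec p) : vsub (vadd x d) x = d.
Proof. by apply: functional_extensionality => l; rewrite /vsub /vadd; ring. Qed.

Lemma vsubK {p} (x y : vec p) : vadd x (vsub y x) = y.
Proof. by apply: functional_extensionality => l; rewrite /vsub /vadd; ring. Qed.

Lemma dot_ebasis {p} (g : vec p) l : dot g (ebasis l) = g l.
Proof.
rewrite -[RHS](rsum_delta l g); apply: rsum_ext => j.
by rewrite /ebasis eq_sym; case: (l == j); ring.
Qed.

Lemma norm2_ebasis {p} (l : 'I_p) : norm2 (ebasis l) = 1.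
Proof. by rewrite /norm2 dot_ebasis /ebasis eqxx. Qed.

Lemma gradient_line {p} (h : vec p -> R) (x d g : vec p) t :
  has_gradient h (vadd x (vscale t d)) g ->
  derivable_pt_lim (fun s => h (vadd x (vscale s d))) t (dot g d).
Proof.
move=> hg eps eps0; have N0 := norm_ge0 d.
(* [+ 1] covers [d = 0], and the factor 2 makes the final inequality strict. *)
have e1 : 0 < eps / (2 * (norm d + 1)) by apply: Rdiv_lt_0_compat; lra.
have [del [del0 hd]] := hg _ e1.
have r0 : 0 < del / (norm d + 1) by apply: Rdiv_lt_0_compat; lra.
exists (mkposreal _ r0) => s s0 /= sr.
have E : vadd x (vscale (t + s) d) = vadd (vadd x (vscale t d)) (vscale s d).
  by apply: functional_extensionality => l; rewrite /vadd /vscale; ring.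
have := hd (vadd x (vscale (t + s) d)); rewrite {1 3}E vaddK norm_vscale dot_vscaler.
have as0 := Rabs_pos_lt s s0.
have h1 : Rabs s * norm d < del.
  have : Rabs s * (norm d + 1) < del / (norm d + 1) * (norm d + 1).
    by apply: Rmult_lt_compat_r; lra.
  have -> : del / (norm d + 1) * (norm d + 1) = del by field; lra.
  by nra.
move=> /(_ h1); set D := h _ - h _ - _.
have -> : (h (vadd x (vscale (t + s) d)) - h (vadd x (vscale t d))) / s - dot g d = D / s.
  by rewrite /D; field.
rewrite /Rdiv Rabs_mult Rabs_inv E vaddK norm_vscale => hD.
apply: (Rle_lt_trans _ (eps / (2 * (norm d + 1)) * (Rabs s * norm d) * / Rabs s)).
  by apply: Rmult_le_compat_r => //; apply/Rlt_le/Rinv_0_lt_compat.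
have -> : eps / (2 * (norm d + 1)) * (Rabs s * norm d) * / Rabs s =
  eps / (2 * (norm d + 1)) * norm d by field; lra.
have : eps / (2 * (norm d + 1)) * (2 * (norm d + 1)) = eps by field; lra.
by nra.
Qed.

(** Identifies the given gradient of f with the average of the local ones. *)
Lemma gradient_unique {p} (h : vec p -> R) (x g1 g2 : vec p) l :
  has_gradient h x g1 -> has_gradient h x g2 -> g1 l = g2 l.
Proof.
have E : x = vadd x (vscale 0 (ebasis l)).
  by apply: functional_extensionality => j; rewrite /vadd /vscale; ring.
rewrite {1 2}E => /gradient_line h1 /gradient_line h2.
by rewrite -(dot_ebasis g1) -(dot_ebasis g2); apply: uniqueness_limite h1 h2.
Qed.

Lemma lipschitz_norm2 {p} (G : vec p -> vec p) Lf y z :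
  norm (vsub (G y) (G z)) <= Lf * norm (vsub y z) ->
  norm2 (vsub (G y) (G z)) <= Lf ^ 2 * norm2 (vsub y z).
Proof.
rewrite -!norm_sqr => h; have := norm_ge0 (vsub (G y) (G z)).
have -> : Lf ^ 2 * (norm (vsub y z) * norm (vsub y z)) =
  (Lf * norm (vsub y z)) * (Lf * norm (vsub y z)) by ring.
by move=> h0; apply: Rmult_le_compat.
Qed.

(** The form in which smoothness is used: it passes to averages by linearity and gives the gradient
    back, so f needs no separate Lipschitz estimate. *)
Definition quad_approx {p} (h : vec p -> R) (G : vec p -> vec p) (Lf : R) : Prop :=
  forall x d, Rabs (h (vadd x d) - h x - dot (G x) d) <= Lf / 2 * norm2 d.

Lemma lipschitz_quad_approx {p} (h : vec p -> R) (G : vec p -> vec p) Lf :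
  0 < Lf -> (forall y, has_gradient h y (G y)) ->
  (forall y z, norm (vsub (G y) (G z)) <= Lf * norm (vsub y z)) ->
  quad_approx h G Lf.
Proof.
move=> L0 hG lG x d.
have side s : s = 1 \/ s = -1 ->
    s * (h (vadd x d) - h x - dot (G x) d) <= Lf / 2 * norm2 d.
  (* The mean value theorem replaces an integral: subtracting Lf |d|^2 t^2 / 2 makes the derivative
     nonpositive, and [s] covers both signs. Since c > 0, Young with weight 1 / (2 Lf c) stands in
     for Cauchy-Schwarz. *)
  move=> s1; pose psi t := s * (h (vadd x (vscale t d)) - t * dot (G x) d)
    - Lf / 2 * norm2 d * (t * t).
  pose psi' t := s * (dot (G (vadd x (vscale t d))) d - 1 * dot (G x) d)
    - Lf / 2 * norm2 d * (1 * t + t * 1).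
  have dpsi t : 0 <= t <= 1 -> derivable_pt_lim psi t (psi' t).
    move=> _; apply: derivable_pt_lim_minus.
      apply: (derivable_pt_lim_scal (fun t => h (vadd x (vscale t d)) - t * dot (G x) d)).
      apply: derivable_pt_lim_minus; first by apply: gradient_line.
      have -> : 1 * dot (G x) d = 1 * dot (G x) d + t * 0 by ring.
      apply: (derivable_pt_lim_mult id (fun _ => dot (G x) d)).
        exact: derivable_pt_lim_id.
      exact: derivable_pt_lim_const.
    apply: (derivable_pt_lim_scal (fun t => t * t)).
    by apply: (derivable_pt_lim_mult id id); exact: derivable_pt_lim_id.
  have [c [psiE [c0 c1]]] := MVT_cor2 psi psi' 0 1 Rlt_0_1 dpsi.
  have E1 : vadd x (vscale 1 d) = vadd x d.
    by apply: functional_extensionality => j; rewrite /vadd /vscale; ring.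
  have E0 : vadd x (vscale 0 d) = x.
    by apply: functional_extensionality => j; rewrite /vadd /vscale; ring.
  move: psiE; rewrite {1 2}/psi E1 E0 => psiE.
  suff : psi' c <= 0 by lra.
  pose e := vsub (G (vadd x (vscale c d))) (G x).
  have eN : norm2 e <= Lf ^ 2 * (c ^ 2 * norm2 d).
    by rewrite -norm2_vscale -(vaddK x (vscale c d)); apply: lipschitz_norm2.
  have eE : dot e d = dot (G (vadd x (vscale c d))) d - dot (G x) d.
    by rewrite /dot -rsum_minus; apply: rsum_ext => j; rewrite /e /vsub; ring.
  have Lc : 0 < Lf * c by exact: Rmult_lt_0_compat.
  have iLc := Rinv_0_lt_compat _ Lc.
  have := young _ _ _ s (/ (Lf * c) / 2) (Lf * c / 2) (dot_quad e d) ltac:(lra)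
    ltac:(case: s1 => ->; field; lra).
  have : / (Lf * c) / 2 * norm2 e <= / (Lf * c) / 2 * (Lf ^ 2 * (c ^ 2 * norm2 d)).
    by apply: Rmult_le_compat_l => //; lra.
  have -> : / (Lf * c) / 2 * (Lf ^ 2 * (c ^ 2 * norm2 d)) = Lf * c / 2 * norm2 d.
    by field; lra.
  by rewrite eE /psi'; lra.
by apply: Rabs_le; have := side 1 (or_introl erefl); have := side (-1) (or_intror erefl); lra.
Qed.

Lemma quad_approx_gradient {p} (h : vec p -> R) (G : vec p -> vec p) Lf x :
  0 < Lf -> quad_approx h G Lf -> has_gradient h x (G x).
Proof.
move=> L0 hq eps eps0; exists (eps / Lf); split; first exact: Rdiv_lt_0_compat.
move=> y yx; have := hq x (vsub y x); rewrite vsubK => h1.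
apply: (Rle_trans _ _ _ h1); rewrite -norm_sqr.
have N := norm_ge0 (vsub y x).
have : norm (vsub y x) * Lf < eps / Lf * Lf by apply: Rmult_lt_compat_r.
have -> : eps / Lf * Lf = eps by field; lra.
by nra.
Qed.

Lemma quad_approx_favg {n p} (fi : 'I_n -> vec p -> R) (gi : 'I_n -> vec p -> vec p) Lf :
  (0 < n)%N -> (forall i, quad_approx (fi i) (gi i) Lf) ->
  quad_approx (favg fi) (fun y => vavg (fun i => gi i y)) Lf.
Proof.
move=> n0 hq x d; have n0R : 0 < INR n by apply: lt_0_INR; apply/ltP.
have dE : dot (vavg (fun i => gi i x)) d = / INR n * rsum (fun i => dot (gi i x) d).
  rewrite /dot rsum_swap -rsum_scal; apply: rsum_ext => l.
  by rewrite rsum_scalr /vavg; ring.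
have -> : favg fi (vadd x d) - favg fi x - dot (vavg (fun i => gi i x)) d =
    / INR n * rsum (fun i => fi i (vadd x d) - fi i x - dot (gi i x) d).
  by rewrite dE /favg !rsum_minus; ring.
set F := fun i => _.
have up : rsum F <= INR n * (Lf / 2 * norm2 d).
  rewrite -rsum_const; apply: rsum_le => i.
  by apply: Rle_trans (hq i x d); exact: Rle_abs.
have lo : - rsum F <= INR n * (Lf / 2 * norm2 d).
  rewrite -rsum_const -rsum_opp; apply: rsum_le => i.
  by apply: Rle_trans (hq i x d); rewrite -Rabs_Ropp; exact: Rle_abs.
have E : Lf / 2 * norm2 d = / INR n * (INR n * (Lf / 2 * norm2 d)) by field; lra.
have i0 := Rinv_0_lt_compat _ n0R.
by apply: Rabs_le; rewrite E; split; nra.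
Qed.

Lemma hatgradE {p} (h : vec p -> R) x delta l :
  hatgrad h x delta l = / delta * (h (vadd x (vscale delta (ebasis l))) - h x).
Proof.
rewrite -[RHS](rsum_delta l (fun l => / delta * (h (vadd x (vscale delta (ebasis l))) - h x))).
by apply: rsum_ext => j; rewrite /ebasis; case: (l == j); ring.
Qed.

(** Each coordinate of the error is a Taylor remainder divided by delta, so at most Lf delta / 2 in
    absolute value. *)
Lemma hatgrad_error {p} (h : vec p -> R) (G : vec p -> vec p) Lf x delta :
  0 < delta -> quad_approx h G Lf ->
  norm2 (vsub (hatgrad h x delta) (G x)) <= INR p * (Lf ^ 2 * delta ^ 2 / 4).
Proof.
move=> d0 hq; rewrite -rsum_const; apply: rsum_le => l.
have := hq x (vscale delta (ebasis l)).
rewrite norm2_vscale dot_vscaler dot_ebasis norm2_ebasis.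
set D := h _ - h _ - _.
have -> : vsub (hatgrad h x delta) (G x) l = / delta * D.
  by rewrite /vsub hatgradE /D; field; lra.
move=> hD; have i0 := Rinv_0_lt_compat _ d0.
have -> : Lf ^ 2 * delta ^ 2 / 4 = (/ delta) ^ 2 * (Lf / 2 * (delta ^ 2 * 1)) ^ 2.
  by field; lra.
have -> : / delta * D * (/ delta * D) = (/ delta) ^ 2 * Rabs D ^ 2.
  by rewrite pow2_abs; ring.
apply: Rmult_le_compat_l; first exact: pow2_ge_0.
by apply: pow_incr; split=> //; exact: Rabs_pos.
Qed.

(** * The Lyapunov function along the algorithm *)

(** As alpha > beta, the weight of |w|^2 exceeds 1/2, which completes the square with |y|^2 / 2 +
    <y, w>. *)
Lemma lyap_ge0 {n} (S : 'I_n -> 'I_n -> R) alpha beta y w :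
  (forall u, 0 <= dot u (mulmv S u)) -> 0 < beta -> beta < alpha ->
  0 <= lyap S alpha beta y w.
Proof.
move=> S0 b0 ab; have := dot_quad y w 1 1; have := S0 w; have := norm2_ge0 w.
have E : alpha / (2 * beta) = / 2 + (alpha - beta) * / (2 * beta) by field; lra.
have i0 : 0 < / (2 * beta) by apply: Rinv_0_lt_compat; lra.
rewrite /lyap E => w0 h1 h2.
have : 0 <= (alpha - beta) * / (2 * beta) * norm2 w.
  by apply: Rmult_le_pos => //; apply: Rmult_le_pos; lra.
by lra.
Qed.

Lemma lyap_le {n} (S : 'I_n -> 'I_n -> R) alpha beta rho2 y w :
  (forall u, dot u (mulmv S u) <= / rho2 * norm2 u) ->
  0 < beta -> beta < alpha -> 0 < rho2 ->
  lyap S alpha beta y w <= c_eps8 rho2 alpha beta * (norm2 y + norm2 w).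
Proof.
move=> S1 b0 ab r0; have := dot_quad y w 1 (-1); have := S1 w.
have y0 := norm2_ge0 y.
have i0 : 0 < / (2 * beta) by apply: Rinv_0_lt_compat; lra.
have j0 : 0 < / rho2 by apply: Rinv_0_lt_compat.
have E : alpha / (2 * beta) = / 2 + (alpha - beta) * / (2 * beta) by field; lra.
have E8 : c_eps8 rho2 alpha beta = 1 + (alpha - beta) * / (2 * beta) + / 2 * / rho2.
  by rewrite /c_eps8; field; lra.
rewrite /lyap E E8 => h1 h2.
have : 0 <= (alpha - beta) * / (2 * beta) * norm2 y.
  by apply: Rmult_le_pos => //; apply: Rmult_le_pos; lra.
have : 0 <= / rho2 * norm2 y by apply: Rmult_le_pos; lra.
by lra.
Qed.

Lemma norm2_chain3 {p} (a b c d : vec p) :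
  norm2 (vsub a d) <= 3 * (norm2 (vsub a b) + norm2 (vsub b c) + norm2 (vsub c d)).
Proof.
rewrite /norm2 /dot -!rsum_plus -rsum_scal; apply: rsum_le => l; rewrite /vsub.
have := pow2_ge_0 (a l - b l - (b l - c l)); have := pow2_ge_0 (a l - b l - (c l - d l)).
by have := pow2_ge_0 (b l - c l - (c l - d l)); lra.
Qed.

Lemma norm2_chain2 {p} (a b c : vec p) :
  norm2 (vsub a c) <= 2 * (norm2 (vsub a b) + norm2 (vsub b c)).
Proof.
rewrite /norm2 /dot -!rsum_plus -rsum_scal; apply: rsum_le => l; rewrite /vsub.
by have := pow2_ge_0 (a l - b l - (b l - c l)); lra.
Qed.

Lemma norm2_vsubC {p} (a b : vec p) : norm2 (vsub a b) = norm2 (vsub b a).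
Proof. by apply: rsum_ext => l; rewrite /vsub; ring. Qed.

Lemma Rmax_big_ge {I : finType} (F : I -> R) i : F i <= \big[Rmax/0]_j F j.
Proof.
have := mem_index_enum i; elim: (index_enum I) => // j s IH.
rewrite in_cons big_cons => /orP [/eqP ->|/IH h]; first exact: Rmax_l.
exact: Rle_trans h (Rmax_r _ _).
Qed.

(** Makes the worst-case delta square summable. The default 0 of the maximum is harmless, and its
    sign is carried through the induction. *)
Lemma Rmax_big_sqr {I : finType} (F : I -> R) :
  (forall i, 0 < F i) -> (\big[Rmax/0]_j F j) ^ 2 <= rsum (fun i => F i ^ 2).
Proof.
move=> F0; suff : 0 <= \big[Rmax/0]_j F j /\
  (\big[Rmax/0]_j F j) ^ 2 <= rsum (fun i => F i ^ 2) by case.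
apply: (big_rec2 (fun a b => 0 <= b /\ b ^ 2 <= a)) => [|i a b _ [b0 ba]]; first lra.
have f0 := F0 i; rewrite /Rmax; case: Rle_dec => _; split; try lra; nra.
Qed.

(** * Averages and deviations over the agents *)

Section Average.
Variables (m p : nat).
Notation n := m.+1.
Implicit Types z : 'I_n -> vec p.

Lemma rsum_vavg z l : rsum (fun i => z i l) = INR n * vavg z l.
Proof. by rewrite /vavg; field; have := INR_succ_gt0 m; lra. Qed.

(** The variance identity, behind the contraction by centring, Jensen's inequality and the formula
    for the K-seminorm. *)
Lemma norm2_col_dev z l :
  norm2 (fun i => z i l - vavg z l) = norm2 (fun i => z i l) - INR n * vavg z l ^ 2.
Proof.
rewrite /norm2 /dot.
rewrite (rsum_ext _ (fun i => z i l * z i l - 2 * vavg z l * z i l + vavg z l ^ 2)); last first.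
  by move=> i; ring.
by rewrite rsum_plus rsum_minus rsum_scal rsum_const rsum_vavg; ring.
Qed.

Lemma norm2_col_dev_le z l :
  norm2 (fun i => z i l - vavg z l) <= norm2 (fun i => z i l).
Proof.
rewrite norm2_col_dev; have := pow2_ge_0 (vavg z l); have := INR_succ_gt0 m; nra.
Qed.

Lemma snorm2_cols z : snorm2 z = rsum (fun l => norm2 (fun i => z i l)).
Proof. exact: rsum_swap. Qed.

Lemma norm2_vavg_le z : INR n * norm2 (vavg z) <= snorm2 z.
Proof.
rewrite snorm2_cols /norm2 {1}/dot -rsum_scal; apply: rsum_le => l.
by have := norm2_ge0 (fun i => z i l - vavg z l); rewrite norm2_col_dev /norm2; lra.
Qed.

Lemma Knorm2_dev z :
  Knorm2 z = rsum (fun l => norm2 (fun i => z i l - vavg z l)).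
Proof.
rewrite /Knorm2 (rsum_ext _ (fun i => rsum (fun l => rsum (fun j =>
  z i l * ((if i == j then 1 else 0) - / INR n) * z j l)))); last first.
  by move=> i; rewrite rsum_swap.
rewrite rsum_swap; apply: rsum_ext => l; rewrite norm2_col_dev.
rewrite (rsum_ext _ (fun i => z i l * z i l - vavg z l * z i l)); last first.
  move=> i; rewrite (rsum_ext _ (fun j => z i l * ((if i == j then 1 else 0) * z j l)
    - / INR n * z i l * z j l)); last by move=> j; case: (i == j); ring.
  by rewrite rsum_minus !rsum_scal (rsum_delta i (fun j => z j l)) /vavg; ring.
by rewrite rsum_minus rsum_scal rsum_vavg /norm2 /dot; ring.
Qed.

Lemma vavg_vsub z1 z2 l : vavg (fun i => vsub (z1 i) (z2 i)) l = vavg z1 l - vavg z2 l.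
Proof. by rewrite /vavg rsum_minus; ring. Qed.

End Average.

(** * Errors and descent along the iterates *)

Section Algorithm.
Variables (m p : nat) (a : 'I_m.+1 -> 'I_m.+1 -> R) (rho rho2 : R).
Notation n := m.+1.
Variables (fi : 'I_n -> vec p -> R) (gi : 'I_n -> vec p -> vec p).
Variables (fstar Lf alpha beta eta : R) (delta : 'I_n -> nat -> R).
Variables (x v : nat -> 'I_n -> vec p) (S : 'I_n -> 'I_n -> R).

Hypotheses (wa : weighted_undirected a)
  (Lrho : is_largest_eigenvalue (laplacian a) rho) (rho0 : 0 < rho)
  (Lrho2 : is_smallest_pos_eigenvalue (laplacian a) rho2)
  (ca : graph_connected a).
Hypotheses (dS : forall u w, dot (mulmv S u) w = dot u (mulmv S w))
  (SL : forall u i, rsum u = 0 -> mulmv S (mulmv (laplacian a) u) i = u i)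
  (S0 : forall u, 0 <= dot u (mulmv S u))
  (S1 : forall u, dot u (mulmv S u) <= / rho2 * norm2 u).
Hypotheses (qi : forall i, quad_approx (fi i) (gi i) Lf)
  (lip : forall i y z, norm (vsub (gi i y) (gi i z)) <= Lf * norm (vsub y z)).
Hypotheses (beta0 : 0 < beta) (ab : beta < alpha) (eta0 : 0 < eta).
Hypotheses (e12 : 0 < c_eps1t Lf rho2 alpha beta - eta * c_eps2t Lf rho alpha beta)
  (e34 : 0 <= c_eps3 rho2 alpha beta - eta * c_eps4 beta)
  (e56 : 0 <= c_eps5t Lf rho2 alpha beta - eta * c_eps6t Lf rho2 alpha beta).
Hypothesis delta0 : forall i k, 0 < delta i k.
Hypotheses (v0 : forall l, rsum (fun j => v 0%nat j l) = 0)
  (xS : forall k i l,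
     x (k.+1) i l = x k i l - eta * (alpha * rsum (fun j => laplacian a i j * x k j l)
                                    + beta * v k i l
                                    + hatgrad (fi i) (x k i) (delta i k) l))
  (vS : forall k i l,
     v (k.+1) i l = v k i l + eta * beta * rsum (fun j => laplacian a i j * x k j l)).

Let L := laplacian a.
Let xbar k := vavg (x k).
Let deltak k := \big[Rmax/0]_(i : 'I_n) delta i k.
Let h k (i : 'I_n) := hatgrad (fi i) (x k i) (delta i k).
Let h0 k (i : 'I_n) := hatgrad (fi i) (xbar k) (deltak k).
Let gradf y := vavg (fun i => gi i y).
Let y k l : vec n := fun i => x k i l - xbar k l.
(** Only the anchor is centred, since [v] keeps mean zero ([rsum_v]). *)
Let w k l : vec n := fun i => v k i l + / beta * (h0 k i l - vavg (h0 k) l).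
Let W k := rsum (fun l => lyap S alpha beta (y k l) (w k l))
  + INR n * (favg fi (xbar k) - fstar).
Let P := 3 * INR n * INR p * Lf ^ 2 / 4.
Let Y k := snorm2 (fun i => vsub (x k i) (xbar k)).

Let rho20 : 0 < rho2. Proof. by case: Lrho2 => _ []. Qed.
Let n0 : 0 < INR n. Proof. exact: INR_succ_gt0. Qed.
Let P0 : 0 <= P.
Proof.
have := pos_INR p; have := pow2_ge_0 Lf => h1 h2.
have := Rmult_le_pos _ _ (Rmult_le_pos _ _ (Rlt_le _ _ n0) h2) h1.
by rewrite /P; lra.
Qed.

Lemma rsum_col_mulmv k l :
  rsum (fun i => rsum (fun j => laplacian a i j * x k j l)) = 0.
Proof. exact: (rsum_mulmv_laplacian _ _ wa (fun j => x k j l)). Qed.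

Lemma rsum_v k l : rsum (fun i => v k i l) = 0.
Proof.
elim: k => [|k IH]; first exact: v0.
by rewrite (rsum_ext _ _ (fun i => vS k i l)) rsum_plus rsum_scal rsum_col_mulmv IH; ring.
Qed.

(** Laplacian terms and [v] both average to zero, so the mean performs inexact gradient descent on
    f. *)
Lemma xbarS k l : xbar k.+1 l = xbar k l - eta * vavg (h k) l.
Proof.
rewrite /xbar /h /vavg (rsum_ext _ _ (fun i => xS k i l)) rsum_minus rsum_scal !rsum_plus.
by rewrite !rsum_scal rsum_col_mulmv rsum_v; ring.
Qed.

Lemma rsum_y k l : rsum (y k l) = 0.
Proof. by rewrite rsum_minus rsum_const rsum_vavg /xbar; ring. Qed.

Lemma mulmv_col k l i : rsum (fun j => laplacian a i j * x k j l) = mulmv L (y k l) i.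
Proof.
rewrite (mulmv_laplacian _ _ (y k l)) -[LHS]/(mulmv L (fun j => x k j l) i).
by rewrite (mulmv_laplacian _ _ _); apply: rsum_ext => j; rewrite /y; ring.
Qed.

Let d k l : vec n := fun i => h k i l - h0 k i l - (vavg (h k) l - vavg (h0 k) l).
Let De k l : vec n := fun i =>
  h0 k.+1 i l - h0 k i l - (vavg (h0 k.+1) l - vavg (h0 k) l).

Lemma lyap_step_col k l :
  lyap S alpha beta (y k.+1 l) (w k.+1 l) <= lyap S alpha beta (y k l) (w k l)
  - eta * ((alpha - beta) * rho2 - 1
           - eta * (beta ^ 2 * rho + (2 * alpha ^ 2 + beta ^ 2) * rho ^ 2)) * norm2 (y k l)
  + (eta + 5 / 2 * eta ^ 2) * norm2 (d k l)
  + c_drift rho2 alpha beta eta * norm2 (De k l).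
Proof.
have uge := laplacian_ge _ _ wa ca rho2 (y k l) Lrho2 (rsum_y k l).
have ule := laplacian_le _ _ wa rho (y k l) Lrho.
have uule := laplacian_sqr_le _ _ wa rho (y k l) Lrho rho0.
have Su i : mulmv S (mulmv L (y k l)) i = y k l i by apply: SL; exact: rsum_y.
have uu : norm2 (mulmv L (y k l)) <= rho ^ 2 * norm2 (y k l).
  have : rho * dot (y k l) (mulmv L (y k l)) <= rho * (rho * norm2 (y k l)).
    by apply: Rmult_le_compat_l => //; lra.
  by rewrite /L; lra.
(* The anchor cancels in [beta * w + d], leaving [beta * v] plus the centred estimate [h]. *)
have yE i : y k.+1 l i = y k l i
    - eta * (alpha * mulmv L (y k l) i + beta * w k l i + d k l i).
  rewrite {1}/y xbarS xS mulmv_col /w /d /y /h; field; lra.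
have wE i : w k.+1 l i = w k l i + eta * beta * mulmv L (y k l) i + / beta * De k l i.
  by rewrite {1}/w vS mulmv_col /w /De; ring.
have := lyap_step _ _ alpha beta eta rho rho2 dS S0 S1 beta0 ab eta0 rho20
  _ _ _ _ _ _ _ Su yE wE uge ule uu.
have : 0 <= eta * (c_eps3 rho2 alpha beta - eta * c_eps4 beta) * norm2 (w k l).
  by apply: Rmult_le_pos; [apply: Rmult_le_pos; lra | exact: norm2_ge0].
by lra.
Qed.

Lemma deltak_gt0 k : 0 < deltak k.
Proof. exact: Rlt_le_trans (delta0 ord0 k) (Rmax_big_ge (fun i => delta i k) ord0). Qed.

Lemma hatgrad_le_deltak k i z :
  norm2 (vsub (hatgrad (fi i) z (delta i k)) (gi i z)) <= INR p * (Lf ^ 2 * deltak k ^ 2 / 4).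
Proof.
apply: (Rle_trans _ _ _ (hatgrad_error _ _ _ z _ (delta0 i k) (qi i))).
apply: Rmult_le_compat_l; first exact: pos_INR.
have := pow_incr (delta i k) (deltak k) 2.
move=> /(_ (conj (Rlt_le _ _ (delta0 i k)) (Rmax_big_ge (fun i => delta i k) i))).
by have := pow2_ge_0 Lf; nra.
Qed.

Lemma hatgrad_xbar_error k i :
  norm2 (vsub (h k i) (gi i (xbar k))) <=
  2 * (INR p * (Lf ^ 2 * deltak k ^ 2 / 4) + Lf ^ 2 * norm2 (vsub (x k i) (xbar k))).
Proof.
apply: (Rle_trans _ _ _ (norm2_chain2 _ (gi i (x k i)) _)).
have := hatgrad_le_deltak k i (x k i).
by have := lipschitz_norm2 _ _ _ _ (lip i (x k i) (xbar k)); rewrite -/(h k i); lra.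
Qed.

(** Passing through the true gradients at x_i and at the mean costs two estimator errors and one
    Lipschitz bound. *)
Lemma estimator_error_le k :
  rsum (fun l => norm2 (d k l)) <= 3 * Lf ^ 2 * Y k + 2 * P * deltak k ^ 2.
Proof.
apply: (Rle_trans _ (snorm2 (fun i => vsub (h k i) (h0 k i)))).
  rewrite snorm2_cols; apply: rsum_le => l.
  apply: Rle_trans (norm2_col_dev_le _ _ (fun i => vsub (h k i) (h0 k i)) l).
  by apply: Req_le; apply: rsum_ext => i; rewrite vavg_vsub.
apply: (Rle_trans _ (rsum (fun i : 'I_n => 3 * Lf ^ 2 * norm2 (vsub (x k i) (xbar k))
    + 3 / 2 * INR p * Lf ^ 2 * deltak k ^ 2))); last first.
  rewrite rsum_plus rsum_scal rsum_const -/(snorm2 (fun i => vsub (x k i) (xbar k))).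
  by rewrite -/(Y k) /P; lra.
apply: rsum_le => i.
apply: (Rle_trans _ _ _ (norm2_chain3 _ (gi i (x k i)) (gi i (xbar k)) _)).
have := hatgrad_le_deltak k i (x k i).
have := lipschitz_norm2 _ _ _ _ (lip i (x k i) (xbar k)).
have := hatgrad_error _ _ _ (xbar k) _ (deltak_gt0 k) (qi i).
rewrite (norm2_vsubC (gi i (xbar k))) -/(h k i) -/(h0 k i); lra.
Qed.

Lemma norm2_xbarS k :
  norm2 (vsub (xbar k.+1) (xbar k)) = eta ^ 2 * norm2 (vavg (h k)).
Proof.
rewrite -norm2_vscale norm2_vsubC; apply: rsum_ext => l.
by rewrite /vsub xbarS /vscale; ring.
Qed.

(** Passing through the true gradients at the two means: the estimator errors belong to times k and
    k+1, and the Lipschitz bound sees the move of the mean. *)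
Lemma anchor_drift_le k :
  rsum (fun l => norm2 (De k l)) <=
  P * (deltak k ^ 2 + deltak k.+1 ^ 2)
  + 3 * Lf ^ 2 * eta ^ 2 * (INR n * norm2 (vavg (h k))).
Proof.
apply: (Rle_trans _ (snorm2 (fun i => vsub (h0 k.+1 i) (h0 k i)))).
  rewrite snorm2_cols; apply: rsum_le => l.
  apply: Rle_trans (norm2_col_dev_le _ _ (fun i => vsub (h0 k.+1 i) (h0 k i)) l).
  by apply: Req_le; apply: rsum_ext => i; rewrite vavg_vsub.
apply: (Rle_trans _ (rsum (fun i : 'I_n => 3 * Lf ^ 2 * eta ^ 2 * norm2 (vavg (h k))
    + 3 / 4 * INR p * Lf ^ 2 * (deltak k ^ 2 + deltak k.+1 ^ 2)))); last first.
  by rewrite rsum_const /P; lra.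
apply: rsum_le => i.
apply: (Rle_trans _ _ _ (norm2_chain3 _ (gi i (xbar k.+1)) (gi i (xbar k)) _)).
have := lipschitz_norm2 _ _ _ _ (lip i (xbar k.+1) (xbar k)).
have := hatgrad_error _ _ _ (xbar k.+1) _ (deltak_gt0 k.+1) (qi i).
have := hatgrad_error _ _ _ (xbar k) _ (deltak_gt0 k) (qi i).
rewrite norm2_xbarS (norm2_vsubC (gi i (xbar k))) -/(h0 k i) -/(h0 k.+1 i); lra.
Qed.

Lemma descent k :
  INR n * favg fi (xbar k.+1) <= INR n * favg fi (xbar k)
  - eta / 2 * (INR n * norm2 (gradf (xbar k)))
  - (eta / 2 - Lf / 2 * eta ^ 2) * (INR n * norm2 (vavg (h k)))
  + eta * Lf ^ 2 * Y k + eta / 3 * P * deltak k ^ 2.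
Proof.
pose g := gradf (xbar k); pose hb := vavg (h k).
have := quad_approx_favg fi gi Lf isT qi (xbar k) (vscale (- eta) hb).
have -> : vadd (xbar k) (vscale (- eta) hb) = xbar k.+1.
  by apply: functional_extensionality => l; rewrite xbarS /vadd /vscale /hb; ring.
rewrite norm2_vscale dot_vscaler -/(gradf (xbar k)) -/g => q.
have {}q := Rle_trans _ _ _ (Rle_abs _) q.
(* Polarisation, rather than Young, keeps - eta |hb|^2 / 2, the budget for the anchor drift. *)
have e1 : 2 * dot g hb = norm2 g + norm2 hb - norm2 (vsub hb g).
  rewrite /norm2 /dot -rsum_scal -rsum_plus -rsum_minus; apply: rsum_ext => l.
  by rewrite /vsub; ring.
have e2 : INR n * norm2 (vsub hb g) <= 2 * Lf ^ 2 * Y k + 2 / 3 * P * deltak k ^ 2.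
  have -> : vsub hb g = vavg (fun i => vsub (h k i) (gi i (xbar k))).
    by apply: functional_extensionality => l; rewrite vavg_vsub.
  apply: (Rle_trans _ _ _ (norm2_vavg_le _ _ _)).
  apply: (Rle_trans _ _ _ (rsum_le _ _ (hatgrad_xbar_error k))).
  rewrite rsum_scal rsum_plus rsum_const rsum_scal.
  by rewrite -/(snorm2 (fun i => vsub (x k i) (xbar k))) -/(Y k) /P; lra.
have e3 : INR n * (favg fi (xbar k.+1) - favg fi (xbar k) + eta * dot g hb)
    <= INR n * (Lf / 2 * (eta ^ 2 * norm2 hb)) by apply: Rmult_le_compat_l; lra.
have e4 : eta / 2 * (INR n * norm2 (vsub hb g)) <=
    eta / 2 * (2 * Lf ^ 2 * Y k + 2 / 3 * P * deltak k ^ 2).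
  by apply: Rmult_le_compat_l; lra.
have e5 : eta * dot g hb = eta / 2 * (norm2 g + norm2 hb - norm2 (vsub hb g)).
  by rewrite -e1; field.
by rewrite e5 in e3; rewrite -/g -/hb; lra.
Qed.

Lemma c_drift_gt0 : 0 < c_drift rho2 alpha beta eta.
Proof.
have b1 : 0 < / beta ^ 2 by apply: Rinv_0_lt_compat; apply: pow_lt.
have b2 : 0 < / (2 * eta * beta) by apply: Rinv_0_lt_compat; nra.
have b3 : 0 < / (2 * eta * beta ^ 2).
  by apply: Rinv_0_lt_compat; apply: Rmult_lt_0_compat; [lra | apply: pow_lt].
have b4 : 0 < / rho2 by apply: Rinv_0_lt_compat.
have b5 : 0 < alpha / beta by apply: Rdiv_lt_0_compat; lra.
have : 0 < (/ beta ^ 2 + / (2 * eta * beta)) * (/ rho2 + alpha / beta).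
  by apply: Rmult_lt_0_compat; lra.
by rewrite /c_drift; lra.
Qed.

Lemma one_step k :
  W k.+1 + c_eps7t Lf rho rho2 alpha beta eta * (Y k + snorm2 (fun _ : 'I_n => gradf (xbar k)))
  <= W k + c_eps11 n p Lf rho2 alpha beta eta * deltak k ^ 2
     + c_eps12 n p Lf rho2 alpha beta eta * deltak k.+1 ^ 2.
Proof.
rewrite /W; move: (rsum_le _ _ (lyap_step_col k)); move: (lyap S alpha beta) => V.
rewrite !rsum_plus rsum_opp !rsum_scal.
have -> : rsum (fun l => norm2 (y k l)) = Y k by rewrite /Y snorm2_cols.
have -> : snorm2 (fun _ : 'I_n => gradf (xbar k)) = INR n * norm2 (gradf (xbar k)).
  exact: rsum_const.
have := descent k; have dl := estimator_error_le k; have Del := anchor_drift_le k.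
have c0 := c_drift_gt0.
set Gn := INR n * norm2 (gradf _); set H := INR n * norm2 (vavg (h k)) in Del *.
have G0 : 0 <= Gn by apply: Rmult_le_pos; [lra | exact: norm2_ge0].
have H0 : 0 <= H by apply: Rmult_le_pos; [lra | exact: norm2_ge0].
have Y0 : 0 <= Y k by apply: rsum_ge0 => i; exact: norm2_ge0.
have D0 := pow2_ge_0 (deltak k); have D1 := pow2_ge_0 (deltak k.+1).
have e2 := pow2_ge_0 eta.
have dl' : (eta + 5 / 2 * eta ^ 2) * rsum (fun l => norm2 (d k l)) <=
    (eta + 5 / 2 * eta ^ 2) * (3 * Lf ^ 2 * Y k + 2 * P * deltak k ^ 2).
  by apply: Rmult_le_compat_l => //; lra.
have Del' := Rmult_le_compat_l _ _ _ (Rlt_le _ _ c0) Del.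
(* This identity explains eps5 and eps6: the drift may spend eta / 8 - Lf eta^2 / 2 per unit of [H],
   and eta (eps5 - eta eps6) is what it leaves unspent. *)
have cE : c_drift rho2 alpha beta eta * (3 * Lf ^ 2 * eta ^ 2) =
    eta / 8 - Lf / 2 * eta ^ 2
    - eta * (c_eps5t Lf rho2 alpha beta - eta * c_eps6t Lf rho2 alpha beta).
  by rewrite /c_drift /c_eps5t /c_eps6t; field; lra.
have hE : c_drift rho2 alpha beta eta * (3 * Lf ^ 2 * eta ^ 2 * H) =
    eta / 8 * H - Lf / 2 * eta ^ 2 * H
    - eta * (c_eps5t Lf rho2 alpha beta - eta * c_eps6t Lf rho2 alpha beta) * H.
  by rewrite -Rmult_assoc cE; ring.
have hH : 0 <= eta * (c_eps5t Lf rho2 alpha beta - eta * c_eps6t Lf rho2 alpha beta) * H.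
  by apply: Rmult_le_pos => //; apply: Rmult_le_pos; lra.
have e12E : c_eps12 n p Lf rho2 alpha beta eta = c_drift rho2 alpha beta eta * P by [].
have e11E : c_eps11 n p Lf rho2 alpha beta eta =
    (15 * eta / 4 + 5 * eta ^ 2) * P + c_drift rho2 alpha beta eta * P by [].
have m1 : c_eps7t Lf rho rho2 alpha beta eta * Y k <=
    eta * (c_eps1t Lf rho2 alpha beta - eta * c_eps2t Lf rho alpha beta) * Y k.
  by apply: Rmult_le_compat_r => //; apply: Rmult_le_compat_l; [lra | exact: Rmin_l].
have m2 : c_eps7t Lf rho rho2 alpha beta eta * Gn <= eta * / 8 * Gn.
  by apply: Rmult_le_compat_r => //; apply: Rmult_le_compat_l; [lra | exact: Rmin_r].
(* These four signs absorb the slack: -1/2 against -1/8 on [Gn], a leftover - 3 eta / 8 on [H], 7/3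
   against 15/4 on P deltak^2, and 4 against 9/2 on Lf^2 Y. *)
have p1 : 0 <= eta * Gn by apply: Rmult_le_pos; lra.
have p2 : 0 <= eta * H by apply: Rmult_le_pos; lra.
have p3 : 0 <= eta * (P * deltak k ^ 2).
  by apply: Rmult_le_pos; [lra | apply: Rmult_le_pos].
have p4 : 0 <= eta * (Lf ^ 2 * Y k).
  by apply: Rmult_le_pos; [lra | apply: Rmult_le_pos => //; exact: pow2_ge_0].
rewrite {}e11E {}e12E; move: m1; rewrite /c_eps1t /c_eps2t.
pose V1 := rsum (fun l => V (y k.+1 l) (w k.+1 l)).
pose V0 := rsum (fun l => V (y k l) (w k l)).
by rewrite -/V1 -/V0; lra.
Qed.

(** * Summation over the iterations *)

Lemma c_eps12_ge0 : 0 <= c_eps12 n p Lf rho2 alpha beta eta.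
Proof.
by apply: (Rmult_le_pos (c_drift rho2 alpha beta eta)); [apply/Rlt_le/c_drift_gt0 | exact: P0].
Qed.

Lemma c_eps11_ge0 : 0 <= c_eps11 n p Lf rho2 alpha beta eta.
Proof.
apply: Rplus_le_le_0_compat c_eps12_ge0; apply: Rmult_le_pos; last exact: P0.
by have := pow2_ge_0 eta; lra.
Qed.

Lemma summed_steps T :
  W T.+1 + c_eps7t Lf rho rho2 alpha beta eta *
    sum_f_R0 (fun k => Y k + snorm2 (fun _ : 'I_n => gradf (xbar k))) T
  <= W 0%nat + c_eps11 n p Lf rho2 alpha beta eta * sum_f_R0 (fun k => deltak k ^ 2) T
     + c_eps12 n p Lf rho2 alpha beta eta * sum_f_R0 (fun k => deltak k.+1 ^ 2) T.
Proof.
elim: T => [|T IH]; first by have := one_step 0; rewrite /sum_f_R0; lra.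
by rewrite !tech5; have := one_step T.+1; lra.
Qed.

Variable deltaa : 'I_n -> R.
Hypothesis delta_sum : forall i, infinite_sum (fun k => delta i k ^ 2) (deltaa i).

Lemma sum_deltak_le T : sum_f_R0 (fun k => deltak k ^ 2) T <= rsum deltaa.
Proof.
apply: (Rle_trans _ (rsum (fun i => sum_f_R0 (fun k => delta i k ^ 2) T))).
  elim: T => [|T IH]; rewrite /=; first exact: Rmax_big_sqr.
  rewrite rsum_plus; apply: Rplus_le_compat => //; exact: Rmax_big_sqr.
apply: rsum_le => i; apply: sum_incr => [|k]; first exact: delta_sum.
exact: pow2_ge_0.
Qed.

(** The shifted sum only loses its term at 0, so both error sums share one bound; hence the factor
    eps11 + eps12. *)
Lemma sum_deltakS_le T : sum_f_R0 (fun k => deltak k.+1 ^ 2) T <= rsum deltaa.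
Proof.
apply: Rle_trans (sum_deltak_le T.+1).
rewrite (decomp_sum _ T.+1); last by apply/ltP.
by have := pow2_ge_0 (deltak 0); rewrite /=; lra.
Qed.

Hypothesis fstar_le : forall z, fstar <= favg fi z.

Lemma W_init :
  W 0%nat <= c_eps8 rho2 alpha beta *
    (Knorm2 (x 0%nat) + Knorm2 (fun i => vadd (v 0%nat i) (vscale (/ beta) (h0 0%nat i)))
     + INR n * (favg fi (xbar 0%nat) - fstar)).
Proof.
rewrite !Knorm2_dev.
have -> : rsum (fun l => norm2 (fun i => vadd (v 0%nat i) (vscale (/ beta) (h0 0%nat i)) l
    - vavg (fun i => vadd (v 0%nat i) (vscale (/ beta) (h0 0%nat i))) l)) =
    rsum (fun l => norm2 (w 0%nat l)).
  apply: rsum_ext => l; congr norm2; apply: functional_extensionality => i.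
  have -> : vavg (fun i => vadd (v 0%nat i) (vscale (/ beta) (h0 0%nat i))) l =
      / beta * vavg (h0 0%nat) l.
    by rewrite {1}/vavg rsum_plus rsum_scal v0 /vavg; ring.
  by rewrite /w /vadd /vscale; ring.
rewrite -rsum_plus Rmult_plus_distr_l -rsum_scal.
apply: Rplus_le_compat; first by apply: rsum_le => l; apply: lyap_le.
have F0 : 0 <= INR n * (favg fi (xbar 0%nat) - fstar).
  by apply: Rmult_le_pos; [lra | have := fstar_le (xbar 0%nat); lra].
(* The optimality gap has weight 1 in W, so this part needs eps8 >= 1, which follows from alpha >
   beta. *)
rewrite -{1}[X in X <= _]Rmult_1_l; apply: Rmult_le_compat_r => //.
have -> : c_eps8 rho2 alpha beta = 1 + (alpha - beta) * / (2 * beta) + / 2 * / rho2.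
  by rewrite /c_eps8; field; lra.
have i1 := Rinv_0_lt_compat _ rho20.
have i2 : 0 < / (2 * beta) by apply: Rinv_0_lt_compat; lra.
have := Rmult_lt_0_compat (alpha - beta) _ ltac:(lra) i2; lra.
Qed.

Lemma W_ge k : INR n * (favg fi (xbar k) - fstar) <= W k.
Proof.
rewrite /W; have : 0 <= rsum (fun l => lyap S alpha beta (y k l) (w k l)); last lra.
by apply: rsum_ge0 => l; apply: lyap_ge0.
Qed.

Lemma convergence_bounds T :
  let ct := c_eps8 rho2 alpha beta *
    (Knorm2 (x 0%nat) + Knorm2 (fun i => vadd (v 0%nat i) (vscale (/ beta) (h0 0%nat i)))
     + INR n * (favg fi (xbar 0%nat) - fstar))
    + (c_eps11 n p Lf rho2 alpha beta eta + c_eps12 n p Lf rho2 alpha beta eta)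
      * rsum deltaa in
  sum_f_R0 (fun k => Y k + snorm2 (fun _ : 'I_n => gradf (xbar k))) T
    <= ct / c_eps7t Lf rho rho2 alpha beta eta /\
  favg fi (xbar T.+1) - fstar <= ct / INR n.
Proof.
move=> ct; have e7 : 0 < c_eps7t Lf rho rho2 alpha beta eta.
  by apply: Rmult_lt_0_compat => //; apply: Rmin_glb_lt => //; lra.
have F0 : 0 <= INR n * (favg fi (xbar T.+1) - fstar).
  by apply: Rmult_le_pos; [lra | have := fstar_le (xbar T.+1); lra].
have S_ge0 : 0 <= sum_f_R0 (fun k => Y k + snorm2 (fun _ : 'I_n => gradf (xbar k))) T.
  apply: cond_pos_sum => k.
  by apply: Rplus_le_le_0_compat; apply: rsum_ge0 => i; exact: norm2_ge0.
have := summed_steps T; have := W_init; have := W_ge T.+1.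
have := Rmult_le_compat_l _ _ _ c_eps11_ge0 (sum_deltak_le T).
have := Rmult_le_compat_l _ _ _ c_eps12_ge0 (sum_deltakS_le T).
have := Rmult_le_pos _ _ (Rlt_le _ _ e7) S_ge0.
by move=> *; split; apply/Rle_div_r => //; rewrite /ct; lra.
Qed.

End Algorithm.

(** * From the parameter conditions to the bounds *)

Lemma Rlt_div_sub_gt0 (eta b c : R) : 0 < c -> eta < b / c -> 0 < b - eta * c.
Proof.
move=> c0 h; have : eta * c < b / c * c by apply: Rmult_lt_compat_r.
have -> : b / c * c = b by field; lra.
by lra.
Qed.

Theorem theorem3
  (n p : nat)
  (* graph, Laplacian and its spectral quantities *)
  (a : 'I_n -> 'I_n -> R) (rho rho2 : R)
  (* local costs, their gradients, gradient of f, optimal value *)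
  (fi : 'I_n -> vec p -> R) (gradfi : 'I_n -> vec p -> vec p)
  (gradf : vec p -> vec p) (fstar Lf : R)
  (* parameters *)
  (kappa2 alpha beta eta : R) (delta : 'I_n -> nat -> R) (deltaa : 'I_n -> R)
  (* iterates of Algorithm 2 *)
  (x v : nat -> 'I_n -> vec p) :
  (* graph setting and (A1) *)
  weighted_undirected a ->
  graph_connected a ->
  is_largest_eigenvalue (laplacian a) rho ->
  is_smallest_pos_eigenvalue (laplacian a) rho2 ->
  (* (A2): X* nonempty, f* = min f *)
  (exists xs : vec p, favg fi xs = fstar) ->
  (forall y : vec p, fstar <= favg fi y) ->
  (* (A3) *)
  0 < Lf ->
  (forall i y, has_gradient (fi i) y (gradfi i y)) ->
  (forall i y z, norm (vsub (gradfi i y) (gradfi i z)) <= Lf * norm (vsub y z)) ->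
  (* gradf is the gradient of f *)
  (forall y, has_gradient (favg fi) y (gradf y)) ->
  (* parameter conditions *)
  1 < kappa2 ->
  Rmax (c_kappa1t Lf rho2 / (kappa2 - 1))
       (Rmax (c_kappa3 kappa2 rho2) (c_kappa4t kappa2 Lf rho2)) < beta ->
  beta + c_kappa1t Lf rho2 < alpha ->
  alpha <= kappa2 * beta ->
  0 < eta ->
  eta < Rmin (c_eps1t Lf rho2 alpha beta / c_eps2t Lf rho alpha beta)
             (Rmin (c_eps3 rho2 alpha beta / c_eps4 beta)
                   (c_eps5t Lf rho2 alpha beta / c_eps6t Lf rho2 alpha beta)) ->
  (forall i k, 0 < delta i k) ->
  (forall i, infinite_sum (fun k => (delta i k) ^ 2) (deltaa i)) ->
  (* Algorithm 2 *)
  (forall l, rsum (fun j => v 0%nat j l) = 0) ->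
  (forall k i l,
     x (S k) i l = x k i l - eta * (alpha * rsum (fun j => laplacian a i j * x k j l)
                                    + beta * v k i l
                                    + hatgrad (fi i) (x k i) (delta i k) l)) ->
  (forall k i l,
     v (S k) i l = v k i l + eta * beta * rsum (fun j => laplacian a i j * x k j l)) ->
  let xbar := fun k => vavg (x k) in
  let deltak := fun k => \big[Rmax/0]_(i : 'I_n) delta i k in
  let h0 := fun k (i : 'I_n) => hatgrad (fi i) (xbar k) (deltak k) in
  let U0 := Knorm2 (x 0%nat)
            + Knorm2 (fun i => vadd (v 0%nat i) (vscale (/ beta) (h0 0%nat i)))
            + INR n * (favg fi (xbar 0%nat) - fstar) in
  let ct := c_eps8 rho2 alpha beta * U0
            + (c_eps11 n p Lf rho2 alpha beta eta + c_eps12 n p Lf rho2 alpha beta eta)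
              * rsum deltaa in
  forall T : nat,
    sum_f_R0 (fun k => snorm2 (fun i => vsub (x k i) (xbar k))
                       + snorm2 (fun _ : 'I_n => gradf (xbar k))) T
      <= ct / c_eps7t Lf rho rho2 alpha beta eta
    /\ favg fi (xbar (S T)) - fstar <= ct / INR n.
Proof.
case: n a fi gradfi delta deltaa x v => [|m] a fi gi delta deltaa x v.
  (* Without agents, the eigenvector for [rho] would have a nonzero entry indexed by the empty
     type. *)
  by move=> _ _ [[? [[[]]]]].
move=> wa ca Lrho Lrho2 _ fstar_le L0 hgi lip hgradf k1 hbeta halpha _ eta0 heta delta0
  delta_sum v0 xS vS xbar deltak h0 U0 ct T.
have rho20 : 0 < rho2 by case: Lrho2 => _ [].
have rho0 : 0 < rho.
  by apply: (Rlt_le_trans _ _ _ rho20); apply: (proj2 Lrho); case: Lrho2.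
have qi i : quad_approx (fi i) (gi i) Lf by apply: lipschitz_quad_approx.
have -> : gradf = fun z => vavg (fun i => gi i z).
  apply: functional_extensionality => z; apply: functional_extensionality => l.
  apply: gradient_unique (hgradf z) _.
  exact: quad_approx_gradient L0 (quad_approx_favg fi gi Lf isT qi).
(* Positivity comes from kappa3 >= 1/4. *)
have beta0 : 0 < beta.
  apply: Rle_lt_trans hbeta; apply: Rle_trans (Rmax_r _ _); apply: Rle_trans (Rmax_l _ _).
  by rewrite /c_kappa3; have := sqrt_pos (1 + 8 * kappa2 + 8 / rho2); lra.
have ab : beta < alpha.
  apply: Rle_lt_trans halpha; have : 0 < c_kappa1t Lf rho2; last lra.
  by apply: Rdiv_lt_0_compat; have := pow2_ge_0 Lf; lra.
have a2 : 0 < alpha ^ 2 by apply: pow_lt; lra.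
have b2 : 0 < beta ^ 2 by apply: pow_lt.
have e12 : 0 < c_eps1t Lf rho2 alpha beta - eta * c_eps2t Lf rho alpha beta.
  apply: Rlt_div_sub_gt0; last by apply: Rlt_le_trans heta (Rmin_l _ _).
  have r2 : 0 < rho ^ 2 by apply: pow_lt.
  have := Rmult_lt_0_compat _ _ b2 rho0; have := pow2_ge_0 Lf.
  have := Rmult_lt_0_compat (2 * alpha ^ 2 + beta ^ 2) _ ltac:(lra) r2.
  by rewrite /c_eps2t; lra.
have {}heta := Rlt_le_trans _ _ _ heta (Rmin_r _ _).
have e34 : 0 <= c_eps3 rho2 alpha beta - eta * c_eps4 beta.
  apply/Rlt_le/Rlt_div_sub_gt0; last by apply: Rlt_le_trans heta (Rmin_l _ _).
  by rewrite /c_eps4; lra.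
have e56 : 0 <= c_eps5t Lf rho2 alpha beta - eta * c_eps6t Lf rho2 alpha beta.
  apply/Rlt_le/Rlt_div_sub_gt0; last by apply: Rlt_le_trans heta (Rmin_r _ _).
  have l2 : 0 < Lf ^ 2 by apply: pow_lt.
  have ir := Rinv_0_lt_compat _ rho20.
  have q1 : 0 < alpha / beta by apply: Rdiv_lt_0_compat; lra.
  have q2 : 0 < 3 / beta ^ 2 by apply: Rdiv_lt_0_compat; lra.
  have := Rmult_lt_0_compat _ _ (Rmult_lt_0_compat _ _ q2
    (_ : 0 < 1 + / rho2 + alpha / beta)) l2.
  by move=> /(_ ltac:(lra)); rewrite /c_eps6t; lra.
have [S [dS SL S0 S1]] := laplacian_pinv _ _ wa ca rho2 Lrho2.
exact: (convergence_bounds m p a rho rho2 fi gi fstar Lf alpha beta eta delta x v S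
  wa Lrho rho0 Lrho2 ca dS SL S0 S1 qi lip beta0 ab eta0 e12 e34 e56 delta0 v0 xS vS
  deltaa delta_sum fstar_le T).
Qed.
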